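(* Let $l,p,n$ be positive integers such that $p$ divides $l$, put $d=l/p$, and assume that either $n>2$, or $n=2$ and $p$ is odd. Let $\eta_l=\exp(2\pi i/l)$, $\eta_d=\eta_l^p$, $K=\mathbb{Q}(\eta_l)$, and let $(r_0,\ldots,r_{d-1},r)\in\mathbb{Z}^{d+1}$. Let $\varphi_p:\mathbb{Z}_K[\mathbf{x},\mathbf{x}^{-1}]\to\mathbb{Z}_K[y,y^{-1}]$ be the $\mathbb{Z}_K$-algebra morphism with $\varphi_p(X_j)=\eta_d^{j}y^{pr_j}$ for $0\le j\le d-1$ and $\varphi_p(x)=y^{pr}$, and let $\bar{\mathcal{H}}=K(y)(\mathcal{H}_{l,p,n})_{\varphi_p}$ be the corresponding cyclotomic Hecke algebra of $G(l,p,n)$. Let $\eta$ be a non-zero complex number, algebraic over $K$, let $\Phi$ denote the minimal polynomial of $\eta$ over $K$, and let $\theta:\mathbb{Z}_K[y,y^{-1}]\to K(\eta)$ be the $\mathbb{Z}_K$-algebra morphism with $\theta(y)=\eta$. Let $E,F\in\mathrm{Irr}(\bar{\mathcal{H}})$. If $E$ and $F$ are in the same $\theta$-block, then they have the same $\Phi$-defect, that is, $\nu_\Phi(s_E(y))=\nu_\Phi(s_F(y))$.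
   Context: $\mathbb{Z}_K$ is the ring of integers of $K$ and $\mathbf{x}=(X_0,\ldots,X_{d-1};x)$ is a set of $d+1$ indeterminates. **Generic Hecke algebra of $G(l,p,n)$.** $\mathcal{H}_{l,p,n}$ is the $\mathbb{Z}[\mathbf{x},\mathbf{x}^{-1}]$-algebra with generators $t_0,\ldots,t_n$ and relations: $(t_0-X_0)\cdots(t_0-X_{d-1})=0$; $(t_j-x)(t_j+1)=0$ for $1\le j\le n$; $t_1t_3t_1=t_3t_1t_3$; $t_jt_{j+1}t_j=t_{j+1}t_jt_{j+1}$ for $2\le j\le n-1$; $t_1t_2t_3t_1t_2t_3=t_3t_1t_2t_3t_1t_2$; $t_1t_j=t_jt_1$ for $4\le j\le n$; $t_it_j=t_jt_i$ for $2\le i<j\le n$, $j-i>1$; $t_0t_j=t_jt_0$ for $3\le j\le n$; $t_0t_1t_2=t_1t_2t_0$; $\underbrace{t_2t_0t_1t_2t_1t_2t_1\cdots}_{p+1\text{ factors}}=\underbrace{t_0t_1t_2t_1t_2t_1t_2\cdots}_{p+1\text{ factors}}$ (relations involving $t_3$ only when $n\ge3$). $(\mathcal{H}_{l,p,n})_{\varphi_p}$ is its specialisation via $\varphi_p$; $\bar{\mathcal{H}}$ is split semisimple. **Relation with the Ariki--Koike algebra.** Put $r_{kd+j}=r_j$ for $0\le j\le d-1$, $1\le k\le p-1$. Let $\mathcal{H}$ be the $K(y)$-algebra with generators $T_0,\ldots,T_{n-1}$ and relations $\prod_{i=0}^{l-1}(T_0-\eta_l^iy^{r_i})=0$; $(T_i-y^{pr})(T_i+1)=0$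 for $1\le i\le n-1$; $T_0T_1T_0T_1=T_1T_0T_1T_0$; $T_iT_{i+1}T_i=T_{i+1}T_iT_{i+1}$ for $1\le i\le n-2$; $T_iT_j=T_jT_i$ for $j-i>1$. Then $\bar{\mathcal{H}}$ is viewed as the subalgebra of $\mathcal{H}$ via $t_0=T_0^p$, $t_1=T_0^{-1}T_1T_0$, $t_j=T_{j-1}$ for $2\le j\le n$. The algebra $\mathcal{H}$ is split semisimple with simple modules $V^{\boldsymbol{\lambda}}$, $\boldsymbol{\lambda}=(\lambda^0,\ldots,\lambda^{l-1})$ an $l$-partition of $n$, labelled in the standard way: $V^{\boldsymbol{\lambda}}$ has a basis indexed by standard tableaux of shape $\boldsymbol{\lambda}$ on which $L_1=T_0$, $L_{k+1}=q^{-1}T_kL_kT_k$ act diagonally, $L_k$ with eigenvalue $q^{j-i}Q_a$ if $k$ occupies the node in row $i$ and column $j$ of component $a$; here and below $q=y^{pr}$ and $Q_i=\eta_l^iy^{r_i}$. **Schur elements.** For partitions $\lambda,\mu$ with conjugates $\lambda',\mu'$ and a node $(i,j)$ of $\lambda$, let $h_{i,j}^{\lambda,\mu}=\lambda_i-i+\mu'_j-j+1$; let $N(\lambda)=\sum_{i\ge1}(i-1)\lambda_i$, $\bar{\boldsymbol{\lambda}}$ the partition obtained by reordering all parts of $\boldsymbol{\lambda}$, $[k]_q=1+q+\cdots+q^{k-1}$, $[\lambda]$ the set of nodes of $\lambda$. The Schur element of $V^{\boldsymbol{\lambda}}$ for the canonical symmetrising trace $\tau$ of $\mathcal{H}$ is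 $$s_{\boldsymbol{\lambda}}=(-1)^{n(l-1)}q^{-N(\bar{\boldsymbol{\lambda}})}\prod_{a=0}^{l-1}\ \prod_{(i,j)\in[\lambda^a]}\Big([h_{i,j}^{\lambda^a,\lambda^a}]_q\prod_{b\ne a}\big(q^{h_{i,j}^{\lambda^a,\lambda^b}}Q_aQ_b^{-1}-1\big)\Big),$$ so $\tau=\sum_{\boldsymbol{\lambda}}s_{\boldsymbol{\lambda}}^{-1}\chi_{V^{\boldsymbol{\lambda}}}$. The canonical symmetrising trace on $\bar{\mathcal{H}}$ is the restriction of $\tau$, and the Schur elements $s_E(y)$, $E\in\mathrm{Irr}(\bar{\mathcal{H}})$, are defined by $\tau|_{\bar{\mathcal{H}}}=\sum_E s_E(y)^{-1}\chi_E$. Equivalently, if $E$ is a composition factor of the restriction of $V^{\boldsymbol{\lambda}}$ to $\bar{\mathcal{H}}$, and $\bar\Omega_{\boldsymbol{\lambda}}$ is the set of (pairwise non-isomorphic) composition factors of this restriction, then $s_E(y)=\frac{|\bar\Omega_{\boldsymbol{\lambda}}|}{p}s_{\boldsymbol{\lambda}}$. $\nu_\Phi$ is the $\Phi$-adic valuation on $K(y)$, and $\nu_\Phi(s_E(y))$ is the $\Phi$-defect of $E$. **$\theta$-blocks.** Write $H=(\mathcal{H}_{l,p,n})_{\varphi_p}$. Let $\mathcal{O}\subset K(y)$ be the localisation of $\mathbb{Z}_K[y,y^{-1}]$ at $\mathrm{Ker}\,\theta$, a discrete valuation ring with uniformiser $\Phi$ and residue field $K(\eta)$. For a simple $K(y)H$-module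 $V$ choose an $\mathcal{O}H$-lattice $V_{\mathcal{O}}$ with $K(y)\otimes_{\mathcal{O}}V_{\mathcal{O}}\cong V$; for a simple $K(\eta)H$-module $M$ the decomposition number $[V:M]$ is the multiplicity of $M$ as a composition factor of $K(\eta)\otimes_{\mathcal{O}}V_{\mathcal{O}}$. The Brauer graph has vertex set $\mathrm{Irr}(K(y)H)$, with $V,V'$ joined by an edge if some $M$ satisfies $[V:M]\ne0\ne[V':M]$. Its connected components are the $\theta$-blocks. *)

(* Defs.v *)
From HB Require Import structures.
From mathcomp Require Import all_boot all_order all_algebra all_field.
From mathcomp Require Import boolp.
From mathcomp Require Import monalg.

Set Implicit Arguments.
Unset Strict Implicit.
Unset Printing Implicit Defensive.

Import Order.TTheory GRing.Theory Num.Theory.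
Local Open Scope ring_scope.
Local Open Scope quotient_scope.

(** * Algebras given by generators and relations *)

Definition word (G : choiceType) : Type := seq G.

Section FreeMonoid.
Variable G : choiceType.
HB.instance Definition _ := Choice.on (word G).
Fact word_unitm (u v : word G) : u ++ v = [::] -> u = [::] /\ v = [::].
Proof. by case: u. Qed.
HB.instance Definition _ := monalg.Choice_isMonomialDef.Build (word G)
  (@catA G) (@cat0s G) (@cats0 G) word_unitm.
End FreeMonoid.

(* The noncommutative polynomial algebra R<G>. *)
Definition free_alg (R : comNzRingType) (G : choiceType) : nzRingType :=
  {malg R[word G]}.

Definition fgen (R : comNzRingType) (G : choiceType) (g : G) : free_alg R G :=
  mkmalgU ([:: g] : word G) (1 : R).

Definition fcst (R : comNzRingType) (G : choiceType) (a : R) : free_alg R G :=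
  mkmalgU (mone : word G) a.

Section TwoSidedQuotient.
Variables (B : nzRingType) (rel : B -> B -> Prop).

(* The two-sided ideal generated by the differences u - v with rel u v. *)
Definition rel_ideal : {pred B} := fun x =>
  `[< forall I : {pred B}, zmod_closed I ->
      (forall a u b, u \in I -> a * u * b \in I) ->
      (forall u v, rel u v -> u - v \in I) -> x \in I >].

Fact rel_ideal_closed : zmod_closed rel_ideal.
Proof.
split=> [|x y /asboolP xI /asboolP yI]; apply/asboolP=> I zI mI rI.
  by case: zI.
by case: (zI) => _; apply; [apply: xI | apply: yI].
Qed.
HB.instance Definition _ := GRing.isZmodClosed.Build B rel_ideal rel_ideal_closed.

Fact rel_idealM a u b : u \in rel_ideal -> a * u * b \in rel_ideal.
Proof.
by move=> /asboolP uI; apply/asboolP=> I zI mI rI; apply/mI/uI.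
Qed.

Fact rel_idealP u v : rel u v -> u - v \in rel_ideal.
Proof. by move=> uv; apply/asboolP=> I _ _; apply. Qed.

Definition rel_quot : Type := Quotient.quot rel_ideal.
HB.instance Definition _ := GRing.Zmodule.on rel_quot.

Definition rq_pi (x : B) : rel_quot := \pi_(Quotient.quot rel_ideal) x.
Definition rq_repr (x : rel_quot) : B := repr (x : Quotient.quot rel_ideal).
Definition rq_one : rel_quot := rq_pi 1.
Definition rq_mul (x y : rel_quot) : rel_quot := rq_pi (rq_repr x * rq_repr y).

Fact rq_piP x y : reflect (rq_pi x = rq_pi y) (x - y \in rel_ideal).
Proof. by rewrite Quotient.idealrBE; exact: eqP. Qed.

Fact rq_reprK : cancel rq_repr rq_pi. Proof. exact: reprK. Qed.

Fact rq_piB : {morph rq_pi : x y / x - y}.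
Proof. by move=> x y; exact: raddfB. Qed.

Fact rq_piM x y : rq_pi (x * y) = rq_mul (rq_pi x) (rq_pi y).
Proof.
apply/rq_piP; set x' := rq_repr _; set y' := rq_repr _.
have xI : x - x' \in rel_ideal by apply/rq_piP; rewrite rq_reprK.
have yI : y - y' \in rel_ideal by apply/rq_piP; rewrite rq_reprK.
have -> : x * y - x' * y' = 1 * (x - x') * y + x' * (y - y') * 1.
  by rewrite mul1r mulr1 mulrBl mulrBr addrA subrK.
by apply: rpredD; apply: rel_idealM.
Qed.

Fact rq_mulA : associative rq_mul.
Proof.
move=> x y z; rewrite -[x]rq_reprK -[y]rq_reprK -[z]rq_reprK.
by rewrite -!rq_piM mulrA.
Qed.
Fact rq_mul1 : left_id rq_one rq_mul.
Proof. by move=> x; rewrite -[x]rq_reprK -rq_piM mul1r. Qed.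
Fact rq_mulr1 : right_id rq_one rq_mul.
Proof. by move=> x; rewrite -[x]rq_reprK -rq_piM mulr1. Qed.
Fact rq_piD : {morph rq_pi : x y / x + y}.
Proof. by move=> x y; exact: raddfD. Qed.
Fact rq_mulDl : left_distributive rq_mul +%R.
Proof.
move=> x y z; rewrite -[x]rq_reprK -[y]rq_reprK -[z]rq_reprK.
by rewrite -rq_piD -!rq_piM -rq_piD mulrDl.
Qed.
Fact rq_mulDr : right_distributive rq_mul +%R.
Proof.
move=> x y z; rewrite -[x]rq_reprK -[y]rq_reprK -[z]rq_reprK.
by rewrite -rq_piD -!rq_piM -rq_piD mulrDr.
Qed.
HB.instance Definition _ := GRing.Zmodule_isPzRing.Build rel_quot
  rq_mulA rq_mul1 rq_mulr1 rq_mulDl rq_mulDr.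

HB.instance Definition _ := GRing.isZmodMorphism.Build B rel_quot rq_pi rq_piB.
Fact rq_pi_monoid : monoid_morphism rq_pi. Proof. by split=> // x y; exact: rq_piM. Qed.
HB.instance Definition _ := GRing.isMonoidMorphism.Build B rel_quot rq_pi rq_pi_monoid.

End TwoSidedQuotient.

Section Presentation.
Variables (R : comNzRingType) (G : choiceType).
Variable rel : free_alg R G -> free_alg R G -> Prop.

(* The R-algebra with generators G and relations u = v for rel u v; it may be
   the zero ring, hence a pzRingType, and its R-algebra structure is given by
   the map pcst. *)
Definition palg : pzRingType := rel_quot rel.
Definition pcst (a : R) : palg := rq_pi rel (fcst G a).
Definition pgen (g : G) : palg := rq_pi rel (fgen R g).
End Presentation.

(** * The Hecke algebra of G(l,p,n) and the Ariki-Koike algebra *)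

(* a b a b ... (k factors) *)
Fixpoint altprod (B : pzRingType) (a b : B) (k : nat) : B :=
  if k is k'.+1 then a * altprod b a k' else 1.

Section HeckeAlgebra.
Variables (R : comNzRingType) (p d n : nat) (X : nat -> R) (x : R).

Let t (j : nat) : free_alg R 'I_n.+1 := fgen R (inord j).
Let cst (a : R) : free_alg R 'I_n.+1 := fcst _ a.

Inductive hecke_rel : free_alg R 'I_n.+1 -> free_alg R 'I_n.+1 -> Prop :=
| HeckeOrder0 : hecke_rel (\prod_(0 <= j < d) (t 0 - cst (X j))) 0
| HeckeOrder j : (1 <= j <= n)%N -> hecke_rel ((t j - cst x) * (t j + 1)) 0
| HeckeBraid13 : (3 <= n)%N ->
    hecke_rel (t 1 * t 3 * t 1) (t 3 * t 1 * t 3)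
| HeckeBraid j : (2 <= j)%N -> (j.+1 <= n)%N ->
    hecke_rel (t j * t j.+1 * t j) (t j.+1 * t j * t j.+1)
| HeckeBraid123 : (3 <= n)%N ->
    hecke_rel (t 1 * t 2 * t 3 * t 1 * t 2 * t 3)
              (t 3 * t 1 * t 2 * t 3 * t 1 * t 2)
| HeckeComm1 j : (4 <= j <= n)%N -> hecke_rel (t 1 * t j) (t j * t 1)
| HeckeComm i j : (2 <= i)%N -> (i.+1 < j <= n)%N ->
    hecke_rel (t i * t j) (t j * t i)
| HeckeComm0 j : (3 <= j <= n)%N -> hecke_rel (t 0 * t j) (t j * t 0)
| HeckeComm012 : hecke_rel (t 0 * t 1 * t 2) (t 1 * t 2 * t 0)
| HeckeBraid012 :
    hecke_rel (t 2 * t 0 * altprod (t 1) (t 2) p.-1)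
              (t 0 * altprod (t 1) (t 2) p).

Definition hecke : pzRingType := palg hecke_rel.
Definition hecke_cst : R -> hecke := @pcst R 'I_n.+1 hecke_rel.
Definition hecke_gen (j : nat) : hecke := pgen hecke_rel (inord j).

End HeckeAlgebra.

Section ArikiKoike.
(* For n > 0 the index type 'I_n.-1.+1 of the generators is 'I_n. *)
Variables (R : comNzRingType) (l n : nat) (Q : nat -> R) (q : R).

Let T (j : nat) : free_alg R 'I_n.-1.+1 := fgen R (inord j).
Let cst (a : R) : free_alg R 'I_n.-1.+1 := fcst _ a.

Inductive ak_rel : free_alg R 'I_n.-1.+1 -> free_alg R 'I_n.-1.+1 -> Prop :=
| AKOrder0 : ak_rel (\prod_(0 <= i < l) (T 0 - cst (Q i))) 0
| AKOrder i : (1 <= i < n)%N -> ak_rel ((T i - cst q) * (T i + 1)) 0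
| AKBraid0 : (2 <= n)%N ->
    ak_rel (T 0 * T 1 * T 0 * T 1) (T 1 * T 0 * T 1 * T 0)
| AKBraid i : (1 <= i)%N -> (i.+1 < n)%N ->
    ak_rel (T i * T i.+1 * T i) (T i.+1 * T i * T i.+1)
| AKComm i j : (i.+1 < j < n)%N -> ak_rel (T i * T j) (T j * T i).

Definition ak : pzRingType := palg ak_rel.
Definition ak_cst : R -> ak := @pcst R 'I_n.-1.+1 ak_rel.
Definition ak_gen (j : nat) : ak := pgen ak_rel (inord j).

End ArikiKoike.

(* Jucys-Murphy elements, numbered from 0: jucys_murphy q k is L_(k+1). *)
Fixpoint jucys_murphy (F : fieldType) (l n : nat) (Q : nat -> F) (q : F)
    (k : nat) : ak l n Q q :=
  if k is k'.+1 then
    ak_cst l n Q q q^-1 * ak_gen l n Q q k * jucys_murphy l n Q q k'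
      * ak_gen l n Q q k
  else ak_gen l n Q q 0.

(** * Modules *)

(* A free module of rank m over F (x)_A H, for an A-algebra H with structure
   map c and a ring map f : A -> F, given by its matrix representation; as in
   the library's mx_representation the matrices act on row vectors. *)
Record hrep (A : Type) (H : pzRingType) (c : A -> H)
    (F : pzRingType) (f : A -> F) (m : nat) := HRep {
  hrep_mx :> {rmorphism H -> 'M[F]_m};
  hrep_scalar : forall a, hrep_mx (c a) = (f a)%:M
}.

Section Modules.
Variables (A : Type) (H : pzRingType) (c : A -> H) (F : fieldType) (f : A -> F).
Local Notation hrep := (hrep c f).

Definition submodule m (V : hrep m) (U : 'M[F]_m) : Prop :=
  forall h, stablemx U (V h).

Definition simple_hrep m (V : hrep m) : Prop :=
  (0 < m)%N /\ forall U, submodule V U -> (U == 0) || row_full U.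

(* The quotient of the submodule U2 of V by the submodule U1 is isomorphic
   to M: some B maps U2 onto M, H-linearly, with kernel U1. *)
Definition subquot_iso m (V : hrep m) (U1 U2 : 'M[F]_m) k (M : hrep k) : Prop :=
  exists B : 'M[F]_(m, k),
    [/\ row_full (U2 *m B), (U2 :&: kermx B == U1)%MS
      & forall h, U2 *m V h *m B = U2 *m B *m M h].

Definition mod_iso m (V : hrep m) k (M : hrep k) : Prop :=
  exists B : 'M[F]_(m, k),
    [/\ row_free B, row_full B & forall h, V h *m B = B *m M h].

Definition composition_series m (V : hrep m) (N : nat) (U : nat -> 'M[F]_m) :=
  [/\ U 0%N = 0, row_full (U N), forall i, (i <= N)%N -> submodule V (U i)
    & forall i, (i < N)%N -> (U i <= U i.+1)%MS /\
        exists k (S : hrep k), simple_hrep S /\ subquot_iso V (U i) (U i.+1) S].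

(* e is the multiplicity of the simple module M as a composition factor of V *)
Definition multiplicity m (V : hrep m) k (M : hrep k) (e : nat) : Prop :=
  exists N U, composition_series V N U /\
    e = #|[set i : 'I_N | `[< subquot_iso V (U i) (U i.+1) M >]]|.

(* Irr of F (x)_A H: a finite, complete and irredundant list of simple
   modules. *)
Record irr_system := IrrSystem {
  irr_idx :> finType;
  irr_deg : irr_idx -> nat;
  irr_mod : forall E : irr_idx, hrep (irr_deg E);
  irr_simple : forall E, simple_hrep (irr_mod E);
  irr_inj : forall E E', mod_iso (irr_mod E) (irr_mod E') -> E = E';
  irr_complete : forall m (V : hrep m), simple_hrep V ->
    exists E, mod_iso V (irr_mod E)
}.

End Modules.

(** * Number fields and Laurent polynomials *)

(* algC is the field of algebraic complex numbers; l.-root (-1) is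
   exp(i pi / l), the root of least nonnegative argument (and -1 for l = 1). *)
Definition zeta (l : nat) : algC := l.-root (-1) ^+ 2.

Section NumberField.
Variable s : seq algC.

(* Q(s): the intersection of all subfields of C containing s *)
Definition in_Qadj : {pred algC} := fun x =>
  `[< forall P : {pred algC}, divring_closed P -> {subset s <= P} -> x \in P >].

Fact in_Qadj_closed : divring_closed in_Qadj.
Proof.
split=> [|x y /asboolP xQ /asboolP yQ|x y /asboolP xQ /asboolP yQ];
  apply/asboolP=> P clP sP; case: (clP) => P1 PB PV //.
  by apply: PB; [apply: xQ | apply: yQ].
by apply: PV; [apply: xQ | apply: yQ].
Qed.
HB.instance Definition _ :=
  GRing.isDivringClosed.Build algC in_Qadj in_Qadj_closed.

Fact mem_Qadj x : x \in s -> x \in in_Qadj.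
Proof. by move=> xs; apply/asboolP=> P _; apply. Qed.

Record Qadj := QAdj { Qadj_val : algC; Qadj_in : Qadj_val \in in_Qadj }.
HB.instance Definition _ := [isSub for Qadj_val].
HB.instance Definition _ := [Choice of Qadj by <:].
HB.instance Definition _ := [SubChoice_isSubComUnitRing of Qadj by <:].
HB.instance Definition _ := [SubComUnitRing_isSubIntegralDomain of Qadj by <:].
HB.instance Definition _ := [SubIntegralDomain_isSubField of Qadj by <:].

(* the ring of integers of Q(s) *)
Definition Qadj_int : {pred Qadj} := fun x => val x \in Aint.

Fact Qadj_int_closed : subring_closed Qadj_int.
Proof.
split=> [|x y xI yI|x y xI yI]; rewrite unfold_in /= ?rmorph1 ?rmorphB ?rmorphM.
- exact: Aint1.
- exact: rpredB.
- exact: rpredM.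
Qed.
HB.instance Definition _ :=
  GRing.isSubringClosed.Build Qadj Qadj_int Qadj_int_closed.

End NumberField.

Notation cyclo l := (Qadj [:: zeta l]).
Notation cyclo_int l := (@Qadj_int [:: zeta l]).
Notation cycloy l := {fraction {poly (cyclo l)}}.
Local Notation "x %:F" := (FracField.tofrac x) : ring_scope.

Section LaurentRing.
Variable l : nat.
Local Notation K := (cyclo l).
Local Notation Ky := (cycloy l).

Definition yvar : Ky := ('X : {poly K})%:F.
Definition kcst (a : K) : Ky := (a%:P)%:F.

Definition zetaK : K := QAdj (mem_Qadj (mem_head (zeta l) [::])).

(* Z_K[y, y^-1] inside K(y) *)
Definition in_laurent : {pred Ky} := fun x =>
  `[< exists (g : {poly K}) (k : nat),
        g \is a polyOver (cyclo_int l) /\ x = g%:F / yvar ^+ k >].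

Fact yvar_neq0 : yvar != 0.
Proof. by rewrite tofrac_eq0 polyX_eq0. Qed.

Fact in_laurent_closed : subring_closed in_laurent.
Proof.
split=> [|_ _ /asboolP[g [k [gI ->]]] /asboolP[g' [k' [g'I ->]]]
         |_ _ /asboolP[g [k [gI ->]]] /asboolP[g' [k' [g'I ->]]]]; apply/asboolP.
- by exists 1, 0%N; rewrite rpred1 rmorph1 expr0 divr1.
- exists (g * 'X^k' - g' * 'X^k), (k + k')%N; split.
    by rewrite rpredB ?rpredM ?rpredX ?polyOverX.
  rewrite rmorphB !rmorphM !rmorphXn exprD /= -/yvar.
  have yN0 i : yvar ^+ i != 0 by exact: expf_neq0 yvar_neq0.
  by rewrite -[in LHS]mulNr addf_div ?mulNr //; exact: yN0.
- exists (g * g'), (k + k')%N; rewrite rpredM //; split=> //.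
  by rewrite rmorphM exprD mulf_div.
Qed.
HB.instance Definition _ :=
  GRing.isSubringClosed.Build Ky in_laurent in_laurent_closed.

Record laurent := Laurent { laurent_val : Ky; laurent_in : laurent_val \in in_laurent }.
HB.instance Definition _ := [isSub for laurent_val].
HB.instance Definition _ := [Choice of laurent by <:].
HB.instance Definition _ := [SubChoice_isSubComNzRing of laurent by <:].

Fact kcst_in (a : K) : a \in cyclo_int l -> kcst a \in in_laurent.
Proof.
move=> aI; apply/asboolP; exists a%:P, 0%N.
by rewrite polyOverC aI expr0 divr1.
Qed.

Fact ypow_in (e : int) : yvar ^ e \in in_laurent.
Proof.
apply/asboolP; case: e => k.
  by exists 'X^k, 0%N; rewrite rpredX ?polyOverX // rmorphXn expr0 divr1.
by exists 1, k.+1; rewrite rpred1 rmorph1 NegzE -exprnN div1r.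
Qed.

Fact zetaK_int : zetaK \in cyclo_int l.
Proof.
rewrite unfold_in /= /zeta; case: l => [|l']; first by rewrite root0C expr0n Aint0.
apply: rpredX; apply: (@Aint_unity_root (l'.+1 * 2)); first by rewrite muln_gt0.
by apply/unity_rootP; rewrite exprM rootCK // sqrrN expr1n.
Qed.

Fact lmonom_in (a : nat) (e : int) :
  kcst (zetaK ^+ a) * yvar ^ e \in in_laurent.
Proof. by apply: rpredM; [apply/kcst_in/rpredX/zetaK_int | apply: ypow_in]. Qed.

(* eta_l ^ a * y ^ e *)
Definition lmonom (a : nat) (e : int) : laurent := Laurent (lmonom_in a e).

(* theta is the Z_K-algebra morphism Z_K[y,y^-1] -> K(eta) with y |-> eta *)
Definition specialisation (eta : algC)
    (theta : {rmorphism laurent -> Qadj [:: zeta l; eta]}) : Prop :=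
  (forall (a : laurent) (u : K), val a = kcst u -> val (theta a) = val u) /\
  (forall a : laurent, val a = yvar -> val (theta a) = eta).

(* Phi is the minimal polynomial of eta over K *)
Definition is_minpoly (eta : algC) (Phi : {poly K}) : Prop :=
  Phi \is monic /\ forall g : {poly K}, root (map_poly val g) eta = (Phi %| g).

Definition poly_mult (Phi g : {poly K}) : nat :=
  \max_(k < size g | Phi ^+ k %| g) k.

(* Phi-adic valuation of a nonzero x (for deg Phi > 0) *)
Definition nu (Phi : {poly K}) (x : Ky) : int :=
  (poly_mult Phi \n_(repr x))%:Z - (poly_mult Phi \d_(repr x))%:Z.

End LaurentRing.

(** * Blocks *)

Section Blocks.
Variables (l : nat) (eta : algC).
Variable theta : {rmorphism laurent l -> Qadj [:: zeta l; eta]}.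
Variables (H : pzRingType) (c : laurent l -> H).
Local Notation Keta := (Qadj [:: zeta l; eta]).
Local Notation Ky := (cycloy l).
Local Notation hrepKy := (hrep c (@laurent_val l)).
Local Notation hrepKeta := (hrep c theta).

(* the localisation O of Z_K[y,y^-1] at Ker theta *)
Definition in_local (x : Ky) : Prop :=
  exists a b : laurent l, theta b != 0 /\ x = val a / val b.

(* graph of the residue map O -> K(eta) *)
Definition residue (x : Ky) (v : Keta) : Prop :=
  exists a b : laurent l,
    [/\ theta b != 0, x = val a / val b & v = theta a / theta b].

(* The O-span of the rows of P is an OH-lattice in V; an OH-lattice with
   scalar extension V is of this form, O being a discrete valuation ring. *)
Definition is_lattice m (V : hrepKy m) (P : 'M[Ky]_m) : Prop :=
  P \in unitmx /\ forall h i j, in_local ((P *m V h *m invmx P) i j).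

(* W is K(eta) (x)_O V_O for the lattice V_O spanned by P *)
Definition is_reduction m (V : hrepKy m) (P : 'M[Ky]_m) (W : hrepKeta m) : Prop :=
  forall h i j, residue ((P *m V h *m invmx P) i j) (W h i j).

(* [V : M] = e *)
Definition decomposition_number m (V : hrepKy m) k (M : hrepKeta k) (e : nat) :=
  exists (P : 'M[Ky]_m) (W : hrepKeta m),
    [/\ is_lattice V P, is_reduction V P W & multiplicity W M e].

Definition brauer_edge m (V : hrepKy m) m' (V' : hrepKy m') : Prop :=
  exists k (M : hrepKeta k) (e e' : nat),
    [/\ simple_hrep M, decomposition_number V M e, decomposition_number V' M e',
        e != 0%N & e' != 0%N].

Definition same_block (Irr : irr_system c (@laurent_val l)) (E F : Irr) : Prop :=
  connect (fun E1 E2 : Irr => `[< brauer_edge (irr_mod E1) (irr_mod E2) >]) E F.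

End Blocks.

(** * Multipartitions, standard tableaux, Schur elements *)

Section Partitions.
(* Partitions are weakly decreasing sequences, possibly with trailing zeros;
   rows and columns are numbered from 0, so that the row i and column j of the
   code are i + 1 and j + 1 in the usual numbering. *)
Definition row_len (lam : seq nat) (i : nat) : nat := nth 0%N lam i.
Definition col_len (lam : seq nat) (j : nat) : nat := count (fun m => j < m)%N lam.

(* lam_i - i + mu'_j - j + 1 *)
Definition hook (lam mu : seq nat) (i j : nat) : int :=
  (row_len lam i)%:Z - i.+1%:Z + (col_len mu j)%:Z - j.+1%:Z + 1.

Definition part_N (lam : seq nat) : nat :=
  \sum_(i < size lam) i * row_len lam i.
End Partitions.

Section Multipartitions.
Variables l n : nat.

(* The parts of an l-partition of n are at most n, and each component has at
   most n of them. *)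
Definition mparts (lam : {ffun 'I_l -> n.-tuple 'I_n.+1}) (a : 'I_l) : seq nat :=
  [seq nat_of_ord k | k <- lam a].

Definition is_mpart (lam : {ffun 'I_l -> n.-tuple 'I_n.+1}) : bool :=
  [forall a, sorted geq (mparts lam a)] && (\sum_a sumn (mparts lam a) == n)%N.

Definition mpart : finType := {lam : {ffun 'I_l -> n.-tuple 'I_n.+1} | is_mpart lam}.

Definition component (lam : mpart) (a : 'I_l) : seq nat := mparts (val lam) a.

(* all parts of lam, reordered *)
Definition mpart_bar (lam : mpart) : seq nat :=
  sort geq (flatten [seq component lam a | a <- enum 'I_l]).

(* Nodes are triples (component, row, column); a standard tableau is given by
   the node occupied by each of the n entries. *)
Definition is_std_tab (lam : mpart) (t : {ffun 'I_n -> 'I_l * 'I_n * 'I_n}) : bool :=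
  [&& injectiveb t,
      [forall k, let: (a, i, j) := t k in j < row_len (component lam a) i]%N
    & [forall k1, forall k2,
        let: (a1, i1, j1) := t k1 in let: (a2, i2, j2) := t k2 in
        (a1 == a2) && ((i1 == i2) && (j1 < j2) || (j1 == j2) && (i1 < i2))
          ==> (k1 < k2)]%N].

Definition std_tab (lam : mpart) : finType :=
  {t : {ffun 'I_n -> 'I_l * 'I_n * 'I_n} | is_std_tab lam t}.

Variables (F : fieldType) (Q : nat -> F) (q : F).

(* q ^ (j - i) Q_a for the node (a, i, j) of t occupied by k *)
Definition tab_eigenvalue (lam : mpart) (t : std_tab lam) (k : 'I_n) : F :=
  let: (a, i, j) := val t k in q ^ (j%:Z - i%:Z) * Q a.

Definition qint (k : nat) : F := \sum_(i < k) q ^+ i.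

(* A diagonal hook length is positive, so the absolute value in the
   q-integer is harmless. *)
Definition ak_schur (lam : mpart) : F :=
  (-1) ^+ (n * l.-1) * q ^- part_N (mpart_bar lam) *
  \prod_(a < l) \prod_(i < n) \prod_(j < row_len (component lam a) i)
    (qint `|hook (component lam a) (component lam a) i j|%N *
     \prod_(b < l | b != a)
       (q ^ hook (component lam a) (component lam b) i j * Q a * (Q b)^-1 - 1)).

Local Notation akrep := (hrep (@ak_cst F l n Q q) id).

(* V is a complete irredundant list of simple modules of the Ariki-Koike
   algebra in the standard labelling: V lam has a basis indexed by standard
   tableaux (the rows of P) consisting of eigenvectors of the Jucys-Murphy
   elements.  For q = 1 the eigenvalues see only the components of the nodes
   and do not determine the labelling; the linear form ak_trace does not
   depend on the remaining choice, because ak_schur lam is then a function of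
   the sizes of the components and of the degree of V lam. *)
Definition standard_labelling
    (V : forall lam : mpart, akrep #|std_tab lam|) : Prop :=
  [/\ forall lam, simple_hrep (V lam),
      forall lam mu, mod_iso (V lam) (V mu) -> lam = mu,
      forall m (W : akrep m), simple_hrep W -> exists lam, mod_iso W (V lam)
    & forall lam, exists2 P : 'M[F]_#|std_tab lam|, P \in unitmx
        & forall k : 'I_n,
          P *m V lam (jucys_murphy l n Q q k) =
          diag_mx (\row_s tab_eigenvalue (enum_val s) k) *m P].

(* the canonical symmetrising trace *)
Definition ak_trace (V : forall lam : mpart, akrep #|std_tab lam|)
    (h : ak l n Q q) : F :=
  \sum_(lam : mpart) (ak_schur lam)^-1 * \tr (V lam h).

End Multipartitions.

(** * The cyclotomic Hecke algebra of G(l,p,n) *)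

Section Cyclotomic.
Variables (l p n : nat) (rs : (l %/ p).-tuple int) (r : int).
Local Notation d := (l %/ p)%N.

(* r_i, extended by r_(kd+j) = r_j *)
Definition rexp (i : nat) : int := rs`_(i %% d).

(* phi_p X_j = eta_d ^ j * y ^ (p r_j), with eta_d = eta_l ^ p, and phi_p x *)
Definition phiX (j : nat) : laurent l := lmonom l (p * j) (p%:Z * rexp j).
Definition phix : laurent l := lmonom l 0 (p%:Z * r).

(* The specialisation of the generic algebra via phi_p, over Z_K[y,y^-1]; its
   scalar extension to K(y) is the cyclotomic Hecke algebra. *)
Definition cyc_hecke : pzRingType := hecke p d n phiX phix.
Definition cyc_cst : laurent l -> cyc_hecke := hecke_cst p d n phiX phix.
Definition cyc_gen : nat -> cyc_hecke := hecke_gen p d n phiX phix.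

Definition cycQ (i : nat) : cycloy l := kcst (zetaK l ^+ i) * yvar l ^ rexp i.
Definition cycq : cycloy l := yvar l ^ (p%:Z * r).

Definition cyc_ak : pzRingType := ak l n cycQ cycq.
Definition cyc_ak_cst : cycloy l -> cyc_ak := ak_cst l n cycQ cycq.
Definition cyc_ak_gen : nat -> cyc_ak := ak_gen l n cycQ cycq.

Definition hecke_in_ak (iota : {rmorphism cyc_hecke -> cyc_ak}) : Prop :=
  [/\ forall a, iota (cyc_cst a) = cyc_ak_cst (val a),
      iota (cyc_gen 0) = cyc_ak_gen 0 ^+ p,
      exists u, [/\ u * cyc_ak_gen 0 = 1, cyc_ak_gen 0 * u = 1
                  & iota (cyc_gen 1) = u * cyc_ak_gen 1 * cyc_ak_gen 0]
    & forall j, (2 <= j <= n)%N -> iota (cyc_gen j) = cyc_ak_gen j.-1].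

(* s E is the Schur element of E: the restriction of the canonical
   symmetrising trace is the sum of the (s E)^-1 chi_E.  Both sides are
   K(y)-linear, so it suffices to compare them on cyc_hecke. *)
Definition schur_elements
    (iota : {rmorphism cyc_hecke -> cyc_ak})
    (V : forall lam : mpart l n, hrep cyc_ak_cst id #|std_tab lam|)
    (Irr : irr_system cyc_cst (@laurent_val l)) (s : Irr -> cycloy l) : Prop :=
  (forall E, s E != 0) /\
  forall h : cyc_hecke,
    ak_trace V (iota h) = \sum_(E : Irr) (s E)^-1 * \tr (irr_mod E h).

End Cyclotomic.

(* Main.v *)
From HB Require Import structures.
Require Import Defs.
From mathcomp Require Import all_boot all_order all_algebra all_field.
From mathcomp Require Import boolp monalg zify ring.

Set Implicit Arguments.
Unset Strict Implicit.
Unset Printing Implicit Defensive.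
Import Order.TTheory GRing.Theory Num.Theory.
Local Open Scope ring_scope.

(** Call q^(j-i) Q_a the content of the node in row i and column j of component
    a, and its value at y = eta the residue of that node.

    The defect of the Schur element of V^lam is a function of the multiset of
    residues of lam.  Up to units this Schur element is a product of terms
    m - 1 with m = q^h Q_a / Q_b, one for each generalised hook length h, and
    such a binomial has valuation 1 or 0 according as m is 1 at eta or not; so
    the defect counts the m that become 1 [nu_ak_schur_hooks].  The generalised
    hook lengths of two partitions are determined by the contents of their
    nodes [hooks_from_contents], so the count is a quadratic expression in the
    multiset of residues, known as Fayers' weight [nu_ak_schur].  Multiplying
    all residues by a p-th root of unity permutes the Q_a among themselves and
    changes nothing [nu_ak_schur_rotation].

    The multiset of residues up to p-th roots of unity is a block invariant.
    The image of the Hecke algebra of G(l,p,n) in the Ariki-Koike algebra is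
    normalised by T_0 and contains T_0^p, while every Jucys-Murphy element is
    T_0 times an element of the image.  Hence a product of power sums of
    Jucys-Murphy elements whose total degree is divisible by p lies in the
    image [jm_psum_im].  It acts on V^lam, hence on each composition factor of
    its restriction, by the corresponding product of power sums of contents,
    and on the modular composition factors by that of residues.  The values of
    these products determine a multiset up to rotation [perm_eq_rotation].

    It remains to compare the Schur element of a simple module E of the
    subalgebra with those of the V^lam.  Characters of simple modules are
    linearly independent in characteristic 0 [characters_independent], so the
    inverse of s_E is the sum of the inverses of the s_lam, each taken with the
    multiplicity of E in V^lam.  All lam that occur have the same contents over
    K(y) up to rotation.  If q is not 1, they are rotations of each other and
    their Schur elements coincide; if q is 1, their components have the same
    sizes and the Schur elements differ by rational factors, namely products of
    hook lengths [ak_schur_same_residues].  So s_E is a constant times s_lam,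
    and has the same defect [constituent]. *)

(** * Hook lengths and contents *)

Section Hooks.
Implicit Types (lam mu : seq nat) (f : int -> int).

Definition node_sum lam (g : nat -> nat -> int) : int :=
  \sum_(i < size lam) \sum_(j < row_len lam i) g i j.

Lemma node_sum_rcons lam m g :
  node_sum (rcons lam m) g = node_sum lam g + \sum_(j < m) g (size lam) j.
Proof.
rewrite /node_sum size_rcons big_ord_recr /=; congr (_ + _).
  by apply: eq_bigr => i _; rewrite /row_len nth_rcons ltn_ord.
by rewrite /row_len nth_rcons ltnn eqxx.
Qed.

Lemma eq_node_sum lam g1 g2 :
  (forall i j, (i < size lam)%N -> (j < row_len lam i)%N -> g1 i j = g2 i j) ->
  node_sum lam g1 = node_sum lam g2.
Proof. by move=> e; apply: eq_bigr => i _; apply: eq_bigr => j _; apply: e. Qed.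

Lemma node_sumD lam g1 g2 :
  node_sum lam (fun i j => g1 i j + g2 i j) = node_sum lam g1 + node_sum lam g2.
Proof. by rewrite -big_split; apply: eq_bigr => i _; rewrite -big_split. Qed.

Lemma sorted_rcons_min lam m : sorted geq (rcons lam m) ->
  sorted geq lam /\ all (leq m) lam.
Proof.
have tr : transitive geq by move=> a b c /= ba ac; exact: leq_trans ac ba.
by rewrite !(sorted_pairwise tr) pairwise_rcons => /andP[].
Qed.

Lemma col_len_rcons lam m j :
  col_len (rcons lam m) j = (col_len lam j + (j < m))%N.
Proof. by rewrite /col_len -cats1 count_cat /= addn0. Qed.

Lemma col_len_all lam m j : all (leq m) lam -> (j < m)%N ->
  col_len lam j = size lam.
Proof.
by move=> lm jm; apply/eqP; rewrite -all_count; apply: sub_all lm => x /(leq_trans jm).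
Qed.

Definition second_diff f (k : int) : int := f k *+ 2 - f (k + 1) - f (k - 1).

(** The inductive step of [hooks_from_contents].  A node added to the other
    partition at the end of row r, in column c, changes the hook lengths along
    this row and this column only, and both sides below are the resulting
    change, with f shifted by the content c - r.  It does not depend on c
    otherwise, because all differences telescope when mu gets a new last row. *)
Lemma add_node_hooks mu c f : sorted geq mu ->
  \sum_(j < c) (f ((col_len mu j)%:Z - j%:Z) - f ((col_len mu j)%:Z - j%:Z - 1))
  + f ((col_len mu c)%:Z - c%:Z)
  + \sum_(i < size mu | (c < row_len mu i)%N)
      (f (i%:Z - (row_len mu i)%:Z) - f (i%:Z - (row_len mu i)%:Z + 1))
  = f 0 - node_sum mu (fun i j => second_diff f (i%:Z - j%:Z)).
Proof.
have tele (g : int -> int) (a : int) (b : nat) : \sum_(j < b) (g (a - j%:Z) - g (a - j%:Z - 1))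
    = g a - g (a - b%:Z).
  elim: b => [|b IH]; first by rewrite big_ord0 subr0 subrr.
  rewrite big_ord_recr /= IH.
  have -> : a - b.+1%:Z = a - b%:Z - 1 by lia.
  ring.
elim/last_ind: mu => [_|mu m IH /sorted_rcons_min [smu amu]].
  rewrite /node_sum /= !big_ord0 /col_len /= subr0.
  by rewrite (tele f 0) subrK addr0.
rewrite node_sum_rcons opprD addrA -IH // size_rcons [X in _ + X = _]big_mkcond big_ord_recr /=.
have -> : row_len (rcons mu m) (size mu) = m by rewrite /row_len nth_rcons ltnn eqxx.
set s := size mu.
have -> : \sum_(i < s) (if (c < row_len (rcons mu m) i)%N then
     f (i%:Z - (row_len (rcons mu m) i)%:Z) - f (i%:Z - (row_len (rcons mu m) i)%:Z + 1)
     else 0) = \sum_(i < s | (c < row_len mu i)%N)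
      (f (i%:Z - (row_len mu i)%:Z) - f (i%:Z - (row_len mu i)%:Z + 1)).
  rewrite [RHS]big_mkcond; apply: eq_bigr => i _.
  by rewrite /row_len nth_rcons ltn_ord.
set A := \sum_(i < s | _) _.
set g := fun k => f (k + 1) - f k.
have HS b : \sum_(j < b) second_diff f (s%:Z - j%:Z) = - (g s%:Z - g (s%:Z - b%:Z)).
  rewrite -tele -sumrN; apply: eq_bigr => j _; rewrite /second_diff /g subrK; ring.
rewrite HS.
have HC b : (b <= m)%N ->
  \sum_(j < b) (f ((col_len (rcons mu m) j)%:Z - j%:Z) - f ((col_len (rcons mu m) j)%:Z - j%:Z - 1))
  = \sum_(j < b) (f ((col_len mu j)%:Z - j%:Z) - f ((col_len mu j)%:Z - j%:Z - 1))
    + (g s%:Z - g (s%:Z - b%:Z)).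
  move=> bm; rewrite -tele -big_split; apply: eq_bigr => j _ /=.
  have jm : (j < m)%N := leq_trans (ltn_ord j) bm.
  rewrite col_len_rcons jm (col_len_all amu jm) -/s /g subrK.
  have -> : (s + true)%:Z - j%:Z = s%:Z - j%:Z + 1 by lia.
  have -> : s%:Z - j%:Z + 1 - 1 = s%:Z - j%:Z by lia.
  ring.
have [cm|mc] := ltnP c m.
  rewrite HC ?(ltnW cm) // col_len_rcons cm (col_len_all amu cm) -/s /g.
  have -> : (s + true)%:Z - c%:Z = s%:Z - c%:Z + 1 by lia.
  ring.
have HD b : (m <= b)%N ->
  \sum_(j < b) (f ((col_len (rcons mu m) j)%:Z - j%:Z) - f ((col_len (rcons mu m) j)%:Z - j%:Z - 1))
  = \sum_(j < b) (f ((col_len mu j)%:Z - j%:Z) - f ((col_len mu j)%:Z - j%:Z - 1))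
    + (g s%:Z - g (s%:Z - m%:Z)).
  elim: b => [|b IHb]; first by rewrite leqn0 => /eqP m0; rewrite HC ?m0.
  rewrite leq_eqVlt => /orP[/eqP e|]; first by rewrite HC ?e.
  rewrite ltnS => mb; rewrite !big_ord_recr /= IHb // col_len_rcons ltnNge mb addn0.
  ring.
rewrite HD // col_len_rcons ltnNge mc addn0; ring.
Qed.

(** The hook lengths of a pair of partitions are determined by the contents of
    their nodes.  For f k = q^k, with V and W the generating functions of the
    contents of lam and mu and W^* that of the opposite contents, the identity
    reads
      sum of q^h + sum of q^-h' = V + W^* - V W^* (1 - q) (1 - q^-1),
    and for lam = mu both sides are the character of a tangent space at a fixed
    point of a quiver variety.  The partition lam is built up node by node, in its last row. *)
Theorem hooks_from_contents lam mu f : sorted geq lam -> sorted geq mu ->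
  node_sum lam (fun i j => f (hook lam mu i j))
  + node_sum mu (fun i j => f (- hook mu lam i j))
  = node_sum lam (fun i j => f (j%:Z - i%:Z))
    + node_sum mu (fun i j => f (i%:Z - j%:Z))
    - node_sum lam (fun i j => node_sum mu (fun i' j' =>
        second_diff f ((j%:Z - i%:Z) - (j'%:Z - i'%:Z)))).
Proof.
move=> slam smu; elim/last_ind: lam slam => [_|lam m IH].
  rewrite /(node_sum [::]) !big_ord0 !add0r subr0.
  apply: eq_bigr => i _; rewrite (reindex_inj rev_ord_inj).
  apply: eq_bigr => j _; congr f; rewrite /hook /col_len /=.
  have := ltn_ord j; move: (nat_of_ord j) => k; lia.
move=> /sorted_rcons_min [slam alam]; move/(_ slam): IH => IH.
elim: m alam => [_|m IHm alam].
  have e i j : hook mu (rcons lam 0) i j = hook mu lam i j.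
    by rewrite /hook col_len_rcons ltn0 addn0.
  rewrite !node_sum_rcons !big_ord0 !addr0.
  rewrite (@eq_node_sum mu _ (fun i j => f (- hook mu lam i j))) => [|i j _ _]; last by rewrite e.
  rewrite -IH; congr (_ + _); apply: eq_node_sum => i j ilam _.
  by rewrite /hook /row_len nth_rcons ilam.
have {}IHm := IHm (sub_all (fun x => @ltnW m x) alam).
set r := size lam; set e : int := m%:Z - r%:Z.
have := add_node_hooks m (fun k => f (e + k)) smu.
rewrite addr0 => H.
move: IHm; rewrite !node_sum_rcons -/r !big_ord_recr /=.
have old_rows k : node_sum lam (fun i j => f (hook (rcons lam k) mu i j))
    = node_sum lam (fun i j => f (hook lam mu i j)).
  by apply: eq_node_sum => i j il _; rewrite /hook /row_len nth_rcons il.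
rewrite !old_rows.
have HA k j : hook (rcons lam k) mu r j = k%:Z - r%:Z + ((col_len mu j)%:Z - j%:Z) - 1.
  rewrite /hook /row_len nth_rcons ltnn eqxx; lia.
have HS j : hook (rcons lam m.+1) mu r j = e + ((col_len mu j)%:Z - j%:Z).
  rewrite HA /e; lia.
have -> : \sum_(j < m) f (hook (rcons lam m) mu r j)
   = \sum_(j < m) f (e + ((col_len mu j)%:Z - j%:Z - 1)).
  by apply: eq_bigr => j _; rewrite HA -[in LHS]addrA.
have -> : \sum_(j < m) f (hook (rcons lam m.+1) mu r j)
   = \sum_(j < m) f (e + ((col_len mu j)%:Z - j%:Z)).
  by apply: eq_bigr => j _; rewrite HS.
have -> : f (hook (rcons lam m.+1) mu r m) = f (e + ((col_len mu m)%:Z - m%:Z)).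
  by rewrite HS.
have -> : node_sum mu (fun i j => f (- hook mu (rcons lam m.+1) i j))
  = node_sum mu (fun i j => f (- hook mu (rcons lam m) i j))
  + \sum_(i < size mu | (m < row_len mu i)%N)
      (f (e + (i%:Z - (row_len mu i)%:Z)) - f (e + (i%:Z - (row_len mu i)%:Z + 1))).
  rewrite [X in _ = _ + X]big_mkcond -big_split; apply: eq_bigr => i _ /=.
  set R := row_len mu i.
  have h0 j : j != m -> hook mu (rcons lam m.+1) i j = hook mu (rcons lam m) i j.
    by move=> jm; rewrite /hook !col_len_rcons ltnS leq_eqVlt (negbTE jm).
  case: ltnP => [mR|Rm].
    rewrite (bigD1 (Ordinal mR)) //= [in RHS](bigD1 (Ordinal mR)) //=.
    have -> : \sum_(j < R | j != Ordinal mR) f (- hook mu (rcons lam m.+1) i j)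
      = \sum_(j < R | j != Ordinal mR) f (- hook mu (rcons lam m) i j).
      by apply: eq_bigr => j jm; rewrite h0.
    have -> : - hook mu (rcons lam m.+1) i m = e + (i%:Z - R%:Z).
      by rewrite /hook -/R col_len_rcons ltnSn (col_len_all alam) // -/r /e; lia.
    have -> : - hook mu (rcons lam m) i m = e + (i%:Z - R%:Z + 1).
      by rewrite /hook -/R col_len_rcons ltnn (col_len_all alam) // -/r /e; lia.
    ring.
  rewrite addr0; apply: eq_bigr => j _; rewrite h0 //.
  by rewrite neq_ltn (leq_trans (ltn_ord j) Rm).
have eD : node_sum mu (fun i' j' => second_diff f (m%:Z - r%:Z - (j'%:Z - i'%:Z)))
  = node_sum mu (fun i j => second_diff (fun k => f (e + k)) (i%:Z - j%:Z)).
  apply: eq_node_sum => i j _ _; rewrite /second_diff !addrA opprB !addrA.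
  by rewrite [e + i%:Z - j%:Z]addrAC -/e [e - j%:Z + i%:Z]addrAC.
rewrite eD.
set s1 := \sum_(i < size mu | _) _ in H *.
rewrite sumrB in H.
set u1 := \sum_(i < m) f _ in H *.
set u2 := \sum_(i < m) f _ in H *.
set ns := node_sum mu (fun i j => second_diff _ _) in H *.
rewrite -/e.
set a1 := node_sum lam _; set a2 := node_sum mu _; set a3 := node_sum lam _.
set a4 := node_sum mu _; set a5 := node_sum lam _; set a6 := \sum_(i < m) f _.
set a7 := \sum_(i < m) _.
clearbody a1 a2 a3 a4 a5 a6 a7 ns u1 u2 s1.
by move=> HH; lia.
Qed.

End Hooks.

(** * Multisets up to rotation *)

Section PowerSums.
Variables (F : fieldType) (charF0 : [pchar F] =i pred0).
Implicit Types A B : seq F.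

Definition psum A (a : nat) : F := \sum_(x <- A) x ^+ a.

(** The Lagrange polynomial that isolates one value turns power sums into
    multiplicities. *)
Lemma perm_eq_psum A B : psum A =1 psum B -> perm_eq A B.
Proof.
move=> eAB.
have e (g : {poly F}) : \sum_(x <- A) g.[x] = \sum_(x <- B) g.[x].
  under eq_bigr do rewrite horner_coef.
  under [RHS]eq_bigr do rewrite horner_coef.
  rewrite exchange_big [RHS]exchange_big; apply: eq_bigr => i _ /=.
  by rewrite -!mulr_sumr; congr (_ * _); exact: eAB.
apply/allP => x0 _ /=; pose g := \prod_(y <- rem x0 (undup (A ++ B))) ('X - y%:P).
have ux : uniq (undup (A ++ B)) by exact: undup_uniq.
have gx0 : g.[x0] != 0.
  rewrite /g horner_prod prodf_seq_neq0; apply/allP => y.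
  rewrite (rem_filter _ ux) mem_filter /= => /andP[yx _].
  by rewrite !hornerE subr_eq0 eq_sym.
have gy C : {subset C <= A ++ B} ->
    \sum_(x <- C) g.[x] = g.[x0] *+ count_mem x0 C.
  move=> sC; transitivity (\sum_(x <- C | pred1 x0 x) g.[x0]); last first.
    by rewrite big_const_seq iter_addr_0.
  rewrite [RHS]big_mkcond; apply: eq_big_seq => x xC /=.
  have [->//|xx0] := eqVneq x x0.
  apply/eqP; rewrite /g horner_prod prodf_seq_eq0; apply/hasP; exists x.
    by rewrite (rem_filter _ ux) mem_filter /= xx0 mem_undup sC.
  by rewrite !hornerE subrr.
move/eqP: (e g); rewrite !gy; last 2 first.
- by move=> y yB; rewrite mem_cat yB orbT.
- by move=> y yA; rewrite mem_cat yA.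
rewrite -[_ *+ count_mem x0 A]mulr_natr -[_ *+ count_mem x0 B]mulr_natr.
move/eqP/(mulfI gx0)/eqP.
move: (count_mem _ A) (count_mem _ B) => a b.
wlog ab : a b / (a <= b)%N => [W|].
  by case/orP: (leq_total a b) => h; [apply: W | rewrite eq_sym => /(W _ _ h); rewrite eq_sym].
rewrite eq_sym -subr_eq0 -natrB // (iffLR (pcharf0P F) charF0) subn_eq0 => ba.
by rewrite eqn_leq ab ba.
Qed.

(** Invariants of total degree divisible by p separate the orbits of the
    group of p-th roots of unity.  The ratio of a nonvanishing product of power
    sums of A to that of B depends only on the degree modulo p, and defines a
    homomorphism to the p-th roots of unity on the group of these degrees.
    This group is generated by the least positive degree g, a divisor of p, so
    the homomorphism is the restriction of a |-> eps ^ (j a). *)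
Lemma perm_eq_rotation p eps A B : p.-primitive_root eps ->
  (forall s, (p %| sumn s)%N ->
     \prod_(a <- s) psum A a = \prod_(a <- s) psum B a) ->
  exists j, perm_eq A [seq eps ^+ j * y | y <- B].
Proof.
move=> eps_prim eAB; have p_gt0 := prim_order_gt0 eps_prim.
pose PA s := \prod_(a <- s) psum A a; pose PB s := \prod_(a <- s) psum B a.
have PAX k s : PA (flatten (nseq k s)) = PA s ^+ k.
  elim: k => [|k IH]; first by rewrite /PA big_nil.
  by rewrite exprS -IH /PA /= big_cat.
have PBX k s : PB (flatten (nseq k s)) = PB s ^+ k.
  elim: k => [|k IH]; first by rewrite /PB big_nil.
  by rewrite exprS -IH /PB /= big_cat.
have sX k s : sumn (flatten (nseq k s)) = (k * sumn s)%N.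
  by elim: k => //= k IH; rewrite sumn_cat IH mulSn.
have zAB s : (PA s == 0) = (PB s == 0).
  have := eAB (flatten (nseq p s)); rewrite sX dvdn_mulr // => /(_ isT).
  by rewrite -/(PA _) -/(PB _) PAX PBX => /(congr1 (eq_op^~ 0)); rewrite /= !expf_eq0 p_gt0.
pose good g := `[< exists s, [/\ (0 < g)%N, PA s != 0 & (sumn s = g %[mod p])%N] >].
have ex_g : exists g, good g.
  exists p; apply/boolp.asboolP; exists [::]; split=> //; last by rewrite modnn mod0n.
  by rewrite /PA big_nil oner_eq0.
case: (ex_minnP ex_g) => g /boolp.asboolP [s [g_gt0 PAs sg]] g_min.
have PBs : PB s != 0 by rewrite -zAB.
(* p.-1 * m copies of s have degree - m g modulo p. *)
have key m : exists k, (k = p.-1 * m)%N /\ (sumn (flatten (nseq k s)) + m * g = 0 %[mod p])%N.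
  exists (p.-1 * m)%N; split=> //; rewrite sX -modnDml -modnMmr sg modnMmr modnDml.
  by rewrite -mulnA -{2}[(m * g)%N]mul1n -mulnDl addn1 prednK // modnMr mod0n.
have g_dvd a t : PA t != 0 -> (sumn t = a %[mod p])%N -> (g %| a)%N.
  move=> PAt ta; apply: contraT; rewrite /dvdn -lt0n => am.
  have [k [_ kE]] := key (a %/ g)%N.
  have: (g <= a %% g)%N; last by rewrite leqNgt ltn_mod g_gt0.
  apply: g_min; apply/boolp.asboolP; exists (t ++ flatten (nseq k s)); split=> //.
    by rewrite /PA big_cat -!/(PA _) mulf_neq0 // PAX expf_neq0.
  rewrite sumn_cat -modnDml ta modnDml {1}(divn_eq a g) addnAC -modnDml.
  by rewrite [(_ * g + _)%N]addnC kE mod0n.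
have gp : (g %| p)%N.
  by have := g_dvd p [::]; apply; [rewrite /PA big_nil oner_eq0 | rewrite modnn mod0n].
pose w := PA s / PB s.
have w1 : w ^+ (p %/ g) = 1.
  have e : PA (flatten (nseq (p %/ g) s)) = PB (flatten (nseq (p %/ g) s)).
    by apply: (eAB (flatten _)); rewrite sX /dvdn -modnMmr sg modnMmr divnK ?modnn.
  by rewrite expr_div_n -PAX -PBX e divff // PBX expf_neq0.
have wp : w ^+ p = 1 by rewrite -(divnK gp) exprM w1 expr1n.
have epsg : (p %/ g).-primitive_root (eps ^+ g).
  by have := dvdn_prim_root eps_prim (dvdn_div gp); rewrite divnA // mulKn.
have [j wj] := prim_rootP epsg w1.
exists j; apply: perm_eq_psum => a.
have -> : psum [seq eps ^+ j * y | y <- B] a = eps ^+ (j * a) * psum B a.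
  rewrite /psum big_map mulr_sumr; apply: eq_bigr => y _.
  by rewrite exprMn exprM.
have PA1 : PA [:: a] = psum A a by rewrite /PA big_seq1.
have PB1 : PB [:: a] = psum B a by rewrite /PB big_seq1.
have [A0|A0] := eqVneq (psum A a) 0.
  by have := zAB [:: a]; rewrite PA1 PB1 A0 eqxx => /esym/eqP ->; rewrite mulr0.
have ga : (g %| a)%N by apply: (g_dvd a [:: a]); rewrite ?PA1 //= addn0.
have [k [kE kS]] := key (a %/ g)%N.
have := eAB ([:: a] ++ flatten (nseq k s)).
rewrite sumn_cat /dvdn addnC [sumn [:: a]]addn0 -{1}(divnK ga) kS mod0n => /(_ isT).
rewrite !big_cat -!/(PA _) -!/(PB _) PAX PBX PA1 PB1.
have ePA : PA s = w * PB s by rewrite /w divfK.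
rewrite ePA exprMn /= mulrA => /(mulIf (expf_neq0 k PBs)) e.
have wk : w ^+ k * w ^+ (a %/ g) = 1.
  by rewrite -exprD kE -{2}[(a %/ g)%N]mul1n -mulnDl addn1 prednK // exprM wp expr1n.
have -> : eps ^+ (j * a) = w ^+ (a %/ g).
  rewrite wj -!exprM; congr (_ ^+ _); rewrite -{1}(divnK ga); lia.
by rewrite -e mulrCA [w ^+ _ * _]mulrC wk mulr1.
Qed.

End PowerSums.

(** * Composition factors and linear independence of characters *)

Section Characters.
Variables (A : Type) (H : pzRingType) (c : A -> H) (F : fieldType) (f : A -> F).
Local Notation hrep := (hrep c f).

Lemma hrep_exists k (X : H -> 'M[F]_k) :
  zmod_morphism X -> monoid_morphism X -> (forall a, X (c a) = (f a)%:M) ->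
  exists W : hrep k, forall h, W h = X h.
Proof.
move=> Xz Xm Xs.
pose zI := GRing.isZmodMorphism.Build _ _ X Xz.
pose mI := GRing.isMonoidMorphism.Build _ _ X Xm.
pose Y : {rmorphism H -> 'M[F]_k} := HB.pack X zI mI.
by exists (@HRep _ _ c _ f k Y Xs).
Qed.

(** The rows of B span U and C is the projection onto the quotient by U; a left
    inverse D of C and the matrix S with S B + C D = 1 turn them into a
    decomposition of the whole space. *)
Lemma split_submodule m (V : hrep m) (U : 'M[F]_m) : submodule V U ->
  exists (V1 : hrep (\rank U)) (V2 : hrep (\rank (cokermx U))),
  [/\ forall h, \tr (V h) = \tr (V1 h) + \tr (V2 h),
      forall h, V h = 0 -> V1 h = 0
    & forall h, V h = 0 -> V2 h = 0].
Proof.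
move=> sU; pose B := row_base U; pose C := col_base (cokermx U).
pose D := pinvmx C.
have DC : D *m C = 1%:M by rewrite mulVpmx // col_base_full.
have Bfree : row_free B by exact: row_base_free.
have UC (k : nat) (X : 'M_(k, m)) : (X *m C == 0) = (X <= U)%MS.
  have e : X *m cokermx U = X *m C *m row_base (cokermx U) by rewrite -mulmxA mulmx_base.
  rewrite submxE e -[X in _ = (_ == X)](mul0mx _ (row_base (cokermx U))).
  by rewrite (inj_eq (row_free_inj (row_base_free _))).
have BC : B *m C = 0 by apply/eqP; rewrite UC eq_row_base.
pose S := (1%:M - C *m D) *m pinvmx B.
have SB : S *m B = 1%:M - C *m D.
  rewrite mulmxKpV // eq_row_base -UC.
  by rewrite mulmxBl mul1mx -mulmxA DC mulmx1 subrr.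
have BS : B *m S = 1%:M.
  apply: (row_free_inj Bfree).
  by rewrite -mulmxA SB mulmxBr mulmxA BC mul0mx subr0 mulmx1 mul1mx.
have BU : (B <= U)%MS by rewrite eq_row_base.
clearbody S D C B.
have BVC h : B *m V h *m C = 0.
  by apply/eqP; rewrite UC; apply: submx_trans (sU h); rewrite submxMr.
have BV h : B *m V h *m S *m B = B *m V h.
  by rewrite -mulmxA SB mulmxBr mulmxA BVC mul0mx subr0 mulmx1.
have VC h : C *m (D *m V h *m C) = V h *m C.
  have CD : C *m D = 1%:M - S *m B by rewrite SB opprB addrC addrNK.
  by rewrite !mulmxA CD mulmxBl mul1mx mulmxBl -!mulmxA [B *m _]mulmxA BVC mulmx0 subr0.
have [|||V1 V1E] := @hrep_exists _ (fun h => B *m V h *m S).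
- by move=> x y; rewrite rmorphB mulmxBr mulmxBl.
- split=> [|x y]; first by rewrite rmorph1 mulmx1 BS.
  by rewrite rmorphM -[in RHS]mulmxE !mulmxA BV.
- by move=> a; rewrite hrep_scalar mul_mx_scalar -scalemxAl BS scalemx1.
have [|||V2 V2E] := @hrep_exists _ (fun h => D *m V h *m C).
- by move=> x y; rewrite rmorphB mulmxBr mulmxBl.
- split=> [|x y]; first by rewrite rmorph1 mulmx1 DC.
  by rewrite rmorphM -[in RHS]mulmxE -[in RHS]mulmxA VC !mulmxA.
- by move=> a; rewrite hrep_scalar mul_mx_scalar -scalemxAl DC scalemx1.
exists V1, V2; split=> h.
- rewrite V1E V2E -mulmxA mxtrace_mulC -[D *m _ *m _]mulmxA [X in _ + X]mxtrace_mulC.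
  by rewrite -!mulmxA -raddfD -mulmxDr SB addrNK mulmx1.
- by move=> V0; rewrite V1E V0 mulmx0 mul0mx.
- by move=> V0; rewrite V2E V0 mulmx0 mul0mx.
Qed.

(** Take a matrix of maximal rank among those whose row space satisfies P. *)
Lemma subspace_matrix m (P : 'rV[F]_m -> Prop) :
  P 0 -> (forall a u v, P u -> P v -> P (a *: u + v)) ->
  exists U : 'M[F]_m, forall v, P v <-> (v <= U)%MS.
Proof.
move=> P0 PD.
pose good r := `[< exists U : 'M[F]_m, \rank U = r /\ forall v, (v <= U)%MS -> P v >].
have ex_good : exists r, good r.
  exists 0%N; apply/asboolP; exists 0; split; first exact: mxrank0.
  by move=> v; rewrite submx0 => /eqP ->.
have good_le r : good r -> (r <= m)%N.
  by move=> /asboolP[U [<- _]]; exact: rank_leq_col.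
case: (ex_maxnP ex_good good_le) => r /asboolP[U [rU UP]] r_max.
exists U => v; split=> [Pv|]; last exact: UP.
apply: contraT => vU; suff : (\rank (U + v)%MS <= r)%N.
  rewrite -rU leqNgt => /negP[]; rewrite ltn_neqAle mxrankS ?addsmxSl // andbT.
  by apply: contra vU; rewrite (mxrank_leqif_sup (addsmxSl U v)) addsmx_sub => /andP[].
apply: r_max; apply/asboolP; exists (U + v)%MS; split=> // w.
case/sub_addsmxP => -[x y] /= ->; rewrite addrC.
have : (y *m v <= v)%MS by exact: submxMl.
case/sub_rVP => a ->; apply: PD => //; apply: UP; exact: submxMl.
Qed.

Lemma simple_generated m (V : hrep m) (P : 'rV[F]_m -> Prop) v0 :
  simple_hrep V -> P 0 -> (forall a u v, P u -> P v -> P (a *: u + v)) ->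
  (forall h v, P v -> P (v *m V h)) -> P v0 -> v0 != 0 -> forall v, P v.
Proof.
move=> [_ sV] P0 PD PV Pv0 v0N v; have [U UP] := subspace_matrix P0 PD.
have sU : submodule V U.
  move=> h; apply/row_subP => i; rewrite row_mul; apply/UP/PV/UP; exact: row_sub.
case/orP: (sV U sU) => [/eqP U0|Ufull]; last by apply/UP/submx_full.
by have /UP := Pv0; rewrite U0 submx0 (negbTE v0N).
Qed.

(** The kernel and the image of B are submodules. *)
Lemma simple_hom m (V : hrep m) k (W : hrep k) (B : 'M[F]_(m, k)) :
  simple_hrep V -> simple_hrep W -> B != 0 ->
  (forall h, V h *m B = B *m W h) -> mod_iso V W.
Proof.
move=> [_ sV] [_ sW] BN0 BV; exists B; split=> //.
  have sK : submodule V (kermx B).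
    by move=> h; apply/sub_kermxP; rewrite -mulmxA BV mulmxA mulmx_ker mul0mx.
  case/orP: (sV _ sK) => [/eqP|]; first by move/eqP; rewrite kermx_eq0.
  move=> kfull; case/eqP: BN0; apply: (row_full_inj kfull).
  by rewrite mulmx_ker mulmx0.
have sB : submodule W <<B>>%MS.
  by move=> h; rewrite genmxE (eqmxMr _ (genmxE B)) -BV submxMl.
case/orP: (sW _ sB) => [|]; last by rewrite /row_full genmxE.
by rewrite -mxrank_eq0 genmxE mxrank_eq0 (negbTE BN0).
Qed.

Variable Irr : irr_system c f.

(** H is an algebra over the base ring only; the F-linear span of its image is
    taken in the product of the matrix algebras of all simple modules, so that
    an element is the family of its actions. *)
Definition in_span (g : forall E : Irr, 'M[F]_(irr_deg E)) : Prop :=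
  exists x : seq (F * H), forall E, g E = \sum_(u <- x) u.1 *: irr_mod E u.2.

Lemma in_span_mod h : in_span (fun E => irr_mod E h).
Proof. by exists [:: (1, h)] => E; rewrite big_seq1 scale1r. Qed.

Lemma in_spanD a g1 g2 : in_span g1 -> in_span g2 ->
  in_span (fun E => a *: g1 E + g2 E).
Proof.
move=> [x1 e1] [x2 e2]; exists ([seq (a * u.1, u.2) | u <- x1] ++ x2) => E.
rewrite big_cat big_map -e2 e1 scaler_sumr; congr (_ + _).
by apply: eq_bigr => u _; rewrite scalerA.
Qed.

Lemma in_spanM g1 g2 : in_span g1 -> in_span g2 ->
  in_span (fun E => g1 E *m g2 E).
Proof.
move=> [x1 e1] [x2 e2].
exists [seq (u.1 * v.1, u.2 * v.2) | u <- x1, v <- x2] => E.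
rewrite big_allpairs_dep e1 e2 mulmx_suml; apply: eq_bigr => u _.
rewrite mulmx_sumr; apply: eq_bigr => v _ /=.
by rewrite rmorphM -scalemxAl -scalemxAr scalerA.
Qed.

Lemma in_span0 : in_span (fun E => 0).
Proof. by exists [::] => E; rewrite big_nil. Qed.

Lemma eq_in_span g1 g2 : (forall E, g1 E = g2 E) -> in_span g1 -> in_span g2.
Proof. by move=> e [x xE]; exists x => E; rewrite -e. Qed.

Definition kills (ts : seq {E : Irr & 'rV[F]_(irr_deg E)})
    (g : forall E : Irr, 'M[F]_(irr_deg E)) : Prop :=
  forall t, List.In t ts -> tagged t *m g (tag t) = 0.

(** Elements of the span acting as 0 on finitely many vectors of other simple
    modules still move a nonzero vector v of E0 anywhere.  In the inductive
    step, if killing one more vector w of E1 forced v to be killed, then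
    w g |-> v g would be an isomorphism from E1 to E0. *)
Lemma density E0 ts (v v' : 'rV[F]_(irr_deg E0)) :
  (forall t, List.In t ts -> tag t != E0) -> v != 0 ->
  exists g, [/\ in_span g, kills ts g & v *m g E0 = v'].
Proof.
elim: ts v v' => [|[E1 w] ts IH] v v' ts_neq v_neq0.
  pose P u := exists g, [/\ in_span g, kills [::] g & v *m g E0 = u].
  apply: (@simple_generated _ (irr_mod E0) P v) => //; first exact: irr_simple.
  - by exists (fun E => 0); split=> //; [exact: in_span0 | rewrite mulmx0].
  - move=> a _ _ [g1 [s1 _ <-]] [g2 [s2 _ <-]]; exists (fun E => a *: g1 E + g2 E).
    by split=> //; [exact: in_spanD | rewrite mulmxDr scalemxAr].
  - move=> h _ [g [sg _ <-]]; exists (fun E => g E *m irr_mod E h).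
    by split=> //; [apply: in_spanM => //; exact: in_span_mod | rewrite mulmxA].
  by exists (fun E => irr_mod E 1); split=> //; [exact: in_span_mod | rewrite rmorph1 mulmx1].
have E10 : E1 != E0 by apply: (ts_neq (existT _ E1 w)); left.
have {}IH (u u' : 'rV_(irr_deg E0)) : u != 0 ->
    exists g, [/\ in_span g, kills ts g & u *m g E0 = u'].
  by apply: IH => t t_ts; apply: ts_neq; right.
have killsD a g1 g2 : kills ts g1 -> kills ts g2 -> kills ts (fun E => a *: g1 E + g2 E).
  by move=> k1 k2 t t_ts; rewrite mulmxDr -scalemxAr k1 // k2 // scaler0 addr0.
have killsM g h : kills ts g -> kills ts (fun E => g E *m irr_mod E h).
  by move=> k1 t t_ts; rewrite mulmxA k1 // mul0mx.
have [[g0 [sg0 kg0 wg0 vg0]]|no_g] := pselect (exists g,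
    [/\ in_span g, kills ts g, w *m g E1 = 0 & v *m g E0 != 0]).
  pose P u := exists g, [/\ in_span g, kills (existT _ E1 w :: ts) g & v *m g E0 = u].
  apply: (@simple_generated _ (irr_mod E0) P (v *m g0 E0)) => //; first exact: irr_simple.
  - exists (fun E => 0); split; [exact: in_span0 | | by rewrite mulmx0].
    by move=> t _; rewrite mulmx0.
  - move=> a _ _ [g1 [s1 k1 <-]] [g2 [s2 k2 <-]]; exists (fun E => a *: g1 E + g2 E).
    split; [exact: in_spanD | | by rewrite mulmxDr scalemxAr].
    by move=> t tts; rewrite mulmxDr -scalemxAr k1 // k2 // scaler0 addr0.
  - move=> h _ [g [sg kg <-]]; exists (fun E => g E *m irr_mod E h).
    split; [apply: in_spanM => //; exact: in_span_mod | | by rewrite mulmxA].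
    by move=> t tts; rewrite mulmxA kg // mul0mx.
  by exists g0; split=> // t [<- //|]; exact: kg0.
exfalso; have {}no_g g : in_span g -> kills ts g -> w *m g E1 = 0 -> v *m g E0 = 0.
  move=> sg kg wg; apply/eqP/negPn/negP => vg; apply: no_g.
  by exists g; split.
have wT u : exists g, [/\ in_span g, kills ts g & w *m g E1 = u].
  have [g0 [sg0 kg0 vg0]] := IH v v v_neq0.
  have wg0 : w *m g0 E1 != 0.
    by apply: contra v_neq0 => /eqP /(no_g _ sg0 kg0); rewrite vg0 => ->.
  pose P u := exists g, [/\ in_span g, kills ts g & w *m g E1 = u].
  apply: (@simple_generated _ (irr_mod E1) P (w *m g0 E1)) => //; first exact: irr_simple.
  - exists (fun E => 0); split; [exact: in_span0 | | by rewrite mulmx0].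
    by move=> t _; rewrite mulmx0.
  - move=> a _ _ [g1 [s1 k1 <-]] [g2 [s2 k2 <-]]; exists (fun E => a *: g1 E + g2 E).
    split; [exact: in_spanD | exact: killsD | by rewrite mulmxDr scalemxAr].
  - move=> h _ [g [sg kg <-]]; exists (fun E => g E *m irr_mod E h).
    split; [apply: in_spanM => //; exact: in_span_mod | exact: killsM | by rewrite mulmxA].
  by exists g0.
have [G GP] := choice (fun i => wT (delta_mx 0 i)).
pose B := \matrix_(i < irr_deg E1) (v *m G i E0).
have BE g : in_span g -> kills ts g -> w *m g E1 *m B = v *m g E0.
  move=> sg kg; set x := w *m g E1.
  have [sS kS] : in_span (fun E => - \sum_i x 0 i *: G i E + g E) /\
                 kills ts (fun E => - \sum_i x 0 i *: G i E + g E).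
    have [sS kS] : in_span (fun E => \sum_i x 0 i *: G i E) /\
                   kills ts (fun E => \sum_i x 0 i *: G i E).
      elim: (index_enum _) => [|i r [IHs IHk]].
        split; first by apply: eq_in_span in_span0 => E; rewrite big_nil.
        by move=> t _; rewrite big_nil mulmx0.
      have [sGi kGi _] := GP i; split.
        by apply: eq_in_span (in_spanD (x 0 i) sGi IHs) => E; rewrite big_cons.
      by move=> t t_ts; rewrite big_cons; exact: (killsD _ _ _ kGi IHk).
    split.
      by apply: eq_in_span (in_spanD (-1) sS sg) => E; rewrite scaleN1r.
    by move=> t t_ts; rewrite -scaleN1r; exact: (killsD _ _ _ kS kg).
  have := no_g _ sS kS; rewrite !mulmxDr !mulmxN => e.
  have /e/eqP : - (w *m (\sum_i x 0 i *: G i E1)) + w *m g E1 = 0.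
    rewrite -/x mulmx_sumr {2}[x]row_sum_delta addrC; apply/eqP; rewrite subr_eq0; apply/eqP.
    by apply: eq_bigr => i _; rewrite -scalemxAr; have [_ _ ->] := GP i.
  rewrite addrC subr_eq0 => /eqP ->; rewrite mulmx_sumr.
  rewrite [x in LHS]row_sum_delta mulmx_suml; apply: eq_bigr => i _.
  by rewrite -scalemxAl -rowE rowK scalemxAr.
have BN0 : B != 0.
  have [g [sg kg vg]] := IH v v v_neq0.
  by apply: contra v_neq0 => /eqP B0; rewrite -vg -BE // B0 mulmx0.
have BV h : irr_mod E1 h *m B = B *m irr_mod E0 h.
  apply/row_matrixP => i; rewrite !row_mul rowK.
  have [sGi kGi wGi] := GP i.
  have := BE _ (in_spanM sGi (in_span_mod h)) (killsM _ h kGi).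
  by rewrite !mulmxA wGi rowE => ->.
case/eqP: E10; apply: irr_inj.
exact: simple_hom (irr_simple _) (irr_simple _) BN0 BV.
Qed.

(** Split off submodules until only simple modules are left: traces add up, and
    annihilators do not shrink. *)
Lemma character_decomposition m (V : hrep m) : exists mult : Irr -> nat,
  (forall h, \tr (V h) = \sum_E (mult E)%:R * \tr (irr_mod E h)) /\
  (forall E, mult E != 0%N -> forall h, V h = 0 -> irr_mod E h = 0).
Proof.
have [N mN] := ubnP m; elim: N m V mN => // N IH m V mN.
have [m0|m_gt0] := posnP m.
  exists (fun=> 0%N); split=> // h; rewrite big1 => [|E _]; last by rewrite mul0r.
  by subst m; rewrite /mxtrace big_ord0.
have [sV|nsV] := pselect (simple_hrep V).
  have [E [B [Bfree Bfull BV]]] := irr_complete Irr sV.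
  exists (fun E' => (E' == E) : nat); split=> [h|E'].
    rewrite (bigD1 E) //= eqxx mul1r big1 ?addr0; last first.
      by move=> E' /negbTE ->; rewrite mul0r.
    rewrite -[LHS](congr1 mxtrace (mulmx1 _)) -(mulmxVp Bfree) mulmxA BV.
    by rewrite mxtrace_mulC mulmxA mulVpmx // mul1mx.
  move=> Em h V0; have -> : E' = E by apply/eqP; move: Em; case: (E' == E).
  by apply: (row_full_inj Bfull); rewrite -BV V0 mul0mx mulmx0.
have [U sU] : exists2 U, submodule V U & ~~ ((U == 0) || row_full U).
  apply: contrapT => nU; apply: nsV; split=> // U sU; apply: contrapT => U0.
  by apply: nU; exists U => //; apply/negP.
rewrite negb_or -mxrank_eq0 -lt0n => /andP[Urk Ufull].
have [V1 [V2 [trV V1E V2E]]] := split_submodule sU.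
have {}Ufull : (\rank U < m)%N by rewrite ltn_neqAle Ufull rank_leq_col.
have [|m1 [tr1 an1]] := IH _ V1; first by rewrite (leq_trans Ufull).
have [|m2 [tr2 an2]] := IH _ V2.
  by rewrite mxrank_coker -ltnS (leq_trans _ mN) // ltnS ltn_subrL Urk.
exists (fun E => m1 E + m2 E)%N; split=> [h|E].
  rewrite trV tr1 tr2 -big_split; apply: eq_bigr => E _ /=.
  by rewrite natrD mulrDl.
rewrite addn_eq0 negb_and => /orP[mE|mE] h V0.
  exact: an1 (V1E _ V0).
exact: an2 (V2E _ V0).
Qed.

End Characters.

Section Idempotents.
Variable F : fieldType.

Lemma mxtrace_idempotent m (e : 'M[F]_m) : e *m e = e -> \tr e = (\rank e)%:R.
Proof.
move=> ee; rewrite -[in LHS](mulmx_base e) mxtrace_mulC.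
suff -> : row_base e *m col_base e = 1%:M by rewrite mxtrace1.
apply: (row_full_inj (col_base_full e)); apply: (row_free_inj (row_base_free e)).
by rewrite mulmx1 mulmx_base mulmxA mulmx_base -mulmxA mulmx_base.
Qed.

(** The Fitting projection onto the part where M is invertible is a polynomial
    in M without constant term, so it stays in any ideal that contains M.  With
    char_poly M = g X^k and g prime to X, it is u X^(k+1) in a Bezout relation
    u X^(k+1) + w g = 1. *)
Lemma fitting_idempotent m (M : 'M[F]_m) v : v != 0 :> 'rV_m -> v *m M = v ->
  exists x : seq F, let e := \sum_(i < size x) x`_i *: iter i (mulmx M) M in
  e *m e = e /\ v *m e = v.
Proof.
case: m M v => [|m] M v v_neq0 vM; first by rewrite [v]thinmx0 eqxx in v_neq0.
have powE i : iter i (mulmx M) M = M ^+ i.+1.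
  by elim: i => [|i IH]; rewrite ?expr1 // exprS -IH.
have chi0 : char_poly M != 0 by rewrite monic_neq0 // char_poly_monic.
have [k [g [g0 chiE]]] : exists k g, ~~ root g 0 /\ char_poly M = g * 'X^k.
  have [k [g g0 gE]] := multiplicity_XsubC (char_poly M) 0.
  by rewrite chi0 /= subr0 in g0 gE *; exists k, g.
have vh (w : {poly F}) : v *m horner_mx M w = w.[1] *: v.
  elim/poly_ind: w => [|w a IH]; first by rewrite rmorph0 mulmx0 horner0 scale0r.
  rewrite rmorphD rmorphM /= horner_mx_X horner_mx_C mulmxDr mulmxA IH.
  by rewrite -scalemxAl vM mul_mx_scalar -scalerDl !hornerE.
have g1 : g.[1] = 0.
  have : root (char_poly M) 1.
    by rewrite -eigenvalue_root_char; apply/eigenvalueP; exists v; rewrite ?scale1r.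
  by rewrite chiE rootM => /orP[/rootP //|/rootP/eqP]; rewrite !hornerE expr1n oner_eq0.
have /Bezout_eq1_coprimepP[[u w] /= uw] : coprimep ('X^(k.+1)) g.
  by rewrite coprimep_expl // coprimep_sym coprimepX.
exists (polyseq (u * 'X^k)); set e := \sum_(i < _) _.
have eE : e = horner_mx M (u * 'X^(k.+1)).
  rewrite exprSr mulrA rmorphM /= horner_mx_X -[u * 'X^k in RHS]coefK poly_def.
  rewrite raddf_sum mulr_suml; apply: eq_bigr => i _ /=.
  by rewrite powE linearZ /= rmorphXn /= horner_mx_X -scalerAl exprSr.
split; last by rewrite eE vh -[u * _](addrK (w * g)) uw !hornerE g1 mulr0 subr0 scale1r.
have e2 : u * 'X^(k.+1) * (u * 'X^(k.+1)) = u * 'X^(k.+1) - u * w * 'X * char_poly M.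
  have e3 : u * 'X^(k.+1) = 1 - w * g by rewrite -uw addrK.
  rewrite {1}e3 mulrBl mul1r chiE exprS; ring.
rewrite eE -[RHS]subr0 -[X in _ - X](mulr0 (horner_mx M (u * w * 'X))).
rewrite -(Cayley_Hamilton M) -rmorphM -rmorphB -e2.
by rewrite [RHS]rmorphM.


Qed.

End Idempotents.

Section Independence.

Lemma In_cat T (t : T) s1 s2 :
  List.In t (s1 ++ s2) <-> List.In t s1 \/ List.In t s2.
Proof. by elim: s1 => [|x s1 IH] /=; intuition. Qed.

Variables (A : Type) (H : pzRingType) (c : A -> H) (F : fieldType) (f : A -> F).
Variables (charF0 : [pchar F] =i pred0) (Irr : irr_system c f).

(** By density some element of the span fixes a nonzero vector of E0 and acts
    as 0 on the other simple modules; its Fitting projection is an idempotent,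
    whose trace is its rank, nonzero in characteristic 0. *)
Theorem characters_independent (a : Irr -> F) :
  (forall h, \sum_E a E * \tr (irr_mod E h) = 0) -> forall E, a E = 0.
Proof.
move=> rel E0.
have relS g : in_span g -> \sum_E a E * \tr (g E) = 0.
  case=> x gE; under eq_bigr do rewrite gE raddf_sum mulr_sumr.
  rewrite exchange_big big1 // => u _ /=.
  transitivity (u.1 * \sum_E a E * \tr (irr_mod E u.2)); last by rewrite rel mulr0.
  by rewrite mulr_sumr; apply: eq_bigr => E _; rewrite mxtraceZ mulrCA.
have deg_gt0 (E : Irr) : (0 < irr_deg E)%N by case: (irr_simple E).
pose v : 'rV[F]_(irr_deg E0) := const_mx 1.
have v_neq0 : v != 0.
  by apply/eqP => /rowP /(_ (Ordinal (deg_gt0 E0))) /eqP; rewrite !mxE oner_eq0.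
pose ts := flatten [seq [seq existT (fun E => 'rV[F]_(irr_deg E)) E (delta_mx 0 i)
  | i <- enum 'I_(irr_deg E)] | E : Irr <- enum (predC1 E0)].
have [t|g [sg kg vg]] := @density _ _ _ _ _ Irr E0 ts v v _ v_neq0.
  rewrite /ts.
  have : all (predC1 E0) (enum (predC1 E0)) by apply/allP => E; rewrite mem_enum.
  elim: (enum (predC1 E0)) => //= E r IH /andP[EE0 /IH {}IH] /In_cat[|/IH //].
  by elim: (enum 'I_(irr_deg E)) => //= i s IHs [<- //|/IHs].
have g0 E : E != E0 -> g E = 0.
  move=> EE0; apply/row_matrixP => i; rewrite row0 rowE.
  apply: (kg (existT (fun E => 'rV[F]_(irr_deg E)) E (delta_mx 0 i))).
  rewrite /ts.
  have : E \in enum (predC1 E0) by rewrite mem_enum.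
  elim: (enum _) => //= E' r IH; rewrite inE => /orP[/eqP <-|/IH in_r]; last first.
    by apply/In_cat; right.
  apply/In_cat; left.
  have : i \in enum 'I_(irr_deg E) by rewrite mem_enum.
  by elim: (enum _) => //= j r' IH'; rewrite inE => /orP[/eqP <-|/IH' in_r]; [left|right].
have [x [ee ve]] := fitting_idempotent v_neq0 vg.
set e := \sum_(i < _) _ in ee ve.
have spow i : in_span (fun E => iter i (mulmx (g E)) (g E)).
  elim: i => [|i IH]; first exact: eq_in_span sg.
  by apply: eq_in_span (in_spanM sg IH).
have : in_span (fun E => \sum_(i < size x) x`_i *: iter i (mulmx (g E)) (g E)).
  elim: (index_enum _) => [|i r IH].
    by apply: eq_in_span (in_span0 _) => E; rewrite big_nil.
  by apply: eq_in_span (in_spanD x`_i (spow i) IH) => E; rewrite big_cons.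
move/relS; rewrite (bigD1 E0) //= -/e big1 => [|E EE0]; last first.
  rewrite big1 ?linear0 ?mulr0 // => i _.
  by case: (nat_of_ord i) => [|j] /=; rewrite g0 // ?mul0mx scaler0.
rewrite addr0 mxtrace_idempotent // => /eqP; rewrite mulf_eq0.
rewrite (iffLR (pcharf0P F) charF0) mxrank_eq0 => /orP[/eqP //|/eqP e0].
by move: v_neq0; rewrite -ve e0 mulmx0 eqxx.
Qed.

End Independence.

Lemma palg_ind (R : comNzRingType) (G : choiceType)
    (rel : free_alg R G -> free_alg R G -> Prop) (P : palg rel -> Prop) :
  (forall a, P (pcst rel a)) -> (forall g, P (pgen rel g)) ->
  (forall x y, P x -> P y -> P (x + y)) ->
  (forall x y, P x -> P y -> P (x * y)) ->
  forall x, P x.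
Proof.
move=> Pc Pg PD PM x; rewrite -[x](rq_reprK (rel := rel)).
have P0 : P 0 by have := Pc 0; rewrite /pcst /fcst monalgU0 raddf0.
rewrite (monalgE (rq_repr x)) raddf_sum; apply: big_ind => // w _ /=.
move: (mcoeff _ _) => a; elim: w => [|g w IH]; first exact: Pc.
have -> : mkmalgU (g :: w : word G) a = fgen R g * mkmalgU w a.
  by rewrite /fgen malgM_def fgmulUU mul1r.
rewrite rmorphM; exact: PM (Pg g) IH.
Qed.

Lemma rq_pi_rel (B : nzRingType) (rel : B -> B -> Prop) u v :
  rel u v -> rq_pi rel u = rq_pi rel v.
Proof. by move=> uv; apply/rq_piP/rel_idealP. Qed.

Section PresentationRelations.
Variables (R : comNzRingType) (G : choiceType).
Variable rel : free_alg R G -> free_alg R G -> Prop.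
Local Notation t := (fgen R).
Local Notation T := (pgen rel).

Lemma palg_comm (a b : G) : rel (t a * t b) (t b * t a) -> T a * T b = T b * T a.
Proof. by move/rq_pi_rel; rewrite !rmorphM. Qed.

Lemma palg_braid4 (a b : G) : rel (t a * t b * t a * t b) (t b * t a * t b * t a) ->
  T a * T b * T a * T b = T b * T a * T b * T a.
Proof. by move/rq_pi_rel; rewrite !rmorphM. Qed.

Lemma palg_quadratic (a : G) x : rel ((t a - fcst G x) * (t a + 1)) 0 ->
  (T a - pcst rel x) * (T a + 1) = 0.
Proof. by move/rq_pi_rel; rewrite rmorphM rmorphB rmorphD rmorph1 rmorph0. Qed.

End PresentationRelations.

(** * Elements of the Hecke algebra acting by symmetric functions *)

Section GradedByNormaliser.
Variables (B : pzRingType) (Im : B -> Prop) (g u : B) (p : nat).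
Hypotheses (ug : u * g = 1) (gu : g * u = 1).
Hypotheses (Im0 : Im 0) (Im1 : Im 1).
Hypothesis ImD : forall x y, Im x -> Im y -> Im (x + y).
Hypothesis ImM : forall x y, Im x -> Im y -> Im (x * y).
Hypothesis Im_conj : forall x, Im x -> Im (g * x * u).
Hypothesis ImgX : Im (g ^+ p).

(** These are the elements of Im g ^ k, as u is the inverse of g. *)
Definition in_deg (k : nat) (x : B) := Im (x * u ^+ k).

Lemma in_degD k x y : in_deg k x -> in_deg k y -> in_deg k (x + y).
Proof. by move=> hx hy; rewrite /in_deg mulrDl; exact: ImD. Qed.

Lemma in_deg_0 k : in_deg k 0.
Proof. by rewrite /in_deg mul0r. Qed.

Lemma in_deg1 : in_deg 0 1.
Proof. by rewrite /in_deg mulr1. Qed.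

Lemma uXgX k : u ^+ k * g ^+ k = 1.
Proof.
elim: k => [|k IH]; first by rewrite mulr1.
by rewrite exprSr exprS mulrA -[_ * u * g]mulrA ug mulr1.
Qed.

Lemma in_degM k m x y : in_deg k x -> in_deg m y -> in_deg (k + m) (x * y).
Proof.
move=> hx hy; rewrite /in_deg.
have -> : x * y * u ^+ (k + m) = (x * u ^+ k) * (g ^+ k * (y * u ^+ m) * u ^+ k).
  by rewrite addnC exprD !mulrA -[x * u ^+ k * _]mulrA uXgX mulr1.
apply: ImM => //; elim: k {hx} => [|k IH]; first by rewrite mul1r mulr1.
have -> : g ^+ k.+1 * (y * u ^+ m) * u ^+ k.+1
    = g * (g ^+ k * (y * u ^+ m) * u ^+ k) * u.
  by rewrite exprS exprSr !mulrA.
exact: Im_conj.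
Qed.

Lemma in_degX k m x : in_deg k x -> in_deg (m * k) (x ^+ m).
Proof.
move=> hx; elim: m => [|m IH]; first exact: in_deg1.
by rewrite exprS mulSn; exact: in_degM.
Qed.

Lemma in_deg_Im k x : (p %| k)%N -> in_deg k x -> Im x.
Proof.
move=> /dvdnP[m ->] hx; have -> : x = x * u ^+ (m * p) * (g ^+ p) ^+ m.
  by rewrite -exprM mulnC -mulrA uXgX mulr1.
apply: ImM => //; elim: m {hx} => [|m IH]; first by rewrite expr0.
by rewrite exprS; exact: ImM.
Qed.

Lemma prod_psum_Im (I : finType) (L : I -> B) s :
  (forall i, in_deg 1 (L i)) -> (p %| sumn s)%N ->
  Im (\prod_(a <- s) \sum_i L i ^+ a).
Proof.
move=> hL ps; apply: in_deg_Im ps _; elim: s => [|a s IH].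
  by rewrite big_nil; exact: in_deg1.
rewrite big_cons; apply: in_degM => //.
apply: big_ind => [|x y|i _]; [exact: in_deg_0 | exact: in_degD |].
by have := in_degX a (hL i); rewrite muln1.
Qed.

End GradedByNormaliser.

Lemma conjK (B : pzRingType) (g u x : B) : g * u = 1 -> g * (u * x * g) * u = x.
Proof. by move=> gu; rewrite !mulrA gu mul1r -mulrA gu mulr1. Qed.

Lemma conj_comm (B : pzRingType) (g u x : B) :
  g * u = 1 -> g * x = x * g -> g * x * u = x.
Proof. by move=> gu ->; rewrite -mulrA gu mulr1. Qed.

Lemma conj_pow (B : pzRingType) (g u : B) k : g * u = 1 -> g * g ^+ k * u = g ^+ k.
Proof. by move=> gu; apply: conj_comm => //; apply: commrX. Qed.

Lemma conj_mul (B : pzRingType) (g u x y : B) :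
  u * g = 1 -> g * (x * y) * u = (g * x * u) * (g * y * u).
Proof. by move=> ug; rewrite -!mulrA [u * (g * _)]mulrA ug mul1r. Qed.

(** The braid relation of length 4 turns the conjugate of T1 by T0 into that of
    u T1 T0 by T1, both T1 and u T1 T0 being images of generators. *)
Lemma conj_braid (B : pzRingType) (T0 T1 u t : B) :
  u * T0 = 1 -> T0 * u = 1 -> t * T1 = 1 ->
  T0 * T1 * T0 * T1 = T1 * T0 * T1 * T0 ->
  T0 * T1 * u = t * (u * T1 * T0) * T1.
Proof.
move=> uT Tu tT br; have e : T1 * (T0 * T1 * u) = u * T1 * T0 * T1.
  have := congr1 (fun z => u * z * u) br; rewrite /= !mulrA uT mul1r.
  by rewrite -!mulrA Tu mulr1 !mulrA => ->; rewrite -!mulrA.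
by rewrite -[LHS]mul1r -tT -mulrA e !mulrA.
Qed.

Lemma quadratic_inverse (B : pzRingType) (t c ci : B) :
  (t - c) * (t + 1) = 0 -> ci * c = 1 -> c * t = t * c -> ci * t = t * ci ->
  let t' := ci * (t + (1 - c)) in t' * t = 1 /\ t * t' = 1.
Proof.
move=> tq cic ct cit t'.
have e : (t + (1 - c)) * t = c.
  apply/eqP; rewrite -subr_eq0 -[X in _ == X]tq; apply/eqP.
  by rewrite [1 - c]addrC addrA mulrDl mul1r -addrA mulrDr mulr1.
have eC : t * (t + (1 - c)) = c by rewrite -[RHS]e mulrDl mulrDr mulrBl mulrBr mul1r mulr1 ct.
by split; [rewrite /t' -mulrA e | rewrite /t' mulrA -cit -mulrA eC].
Qed.

Section ArikiKoikeRelations.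
Variables (R : comUnitRingType) (l n : nat) (Q : nat -> R) (q : R).
Local Notation T := (ak_gen l n Q q).
Local Notation cst := (ak_cst l n Q q).

Lemma ak_cstM a b : cst (a * b) = cst a * cst b.
Proof.
rewrite /ak_cst /pcst -rmorphM; congr (rq_pi _ _).
by rewrite /fcst malgM_def fgmulUU.
Qed.

Lemma ak_cstD a b : cst (a + b) = cst a + cst b.
Proof.
rewrite /ak_cst /pcst -rmorphD; congr (rq_pi _ _).
by rewrite /fcst monalgUD.
Qed.

Lemma ak_cst1 : cst 1 = 1.
Proof. by []. Qed.

Lemma ak_cst0 : cst 0 = 0.
Proof. by rewrite /ak_cst /pcst /fcst monalgU0 raddf0. Qed.

Lemma ak_cstN a : cst (- a) = - cst a.
Proof. by apply: (addIr (cst a)); rewrite addNr -ak_cstD addNr ak_cst0. Qed.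

Lemma ak_cstC a x : cst a * x = x * cst a.
Proof.
rewrite -[x](rq_reprK (rel := _)) /ak_cst /pcst -!rmorphM.
congr (rq_pi _ _); set y := rq_repr x.
rewrite (monalgE y) mulr_sumr mulr_suml; apply: eq_bigr => w _.
by rewrite /fcst !malgM_def !fgmulUU mulrC mul1m mulm1.
Qed.

Lemma ak_quadratic j : (1 <= j < n)%N -> (T j - cst q) * (T j + 1) = 0.
Proof. by move=> jn; exact: palg_quadratic (AKOrder l Q q jn). Qed.

Lemma ak_braid : (2 <= n)%N -> T 0 * T 1 * T 0 * T 1 = T 1 * T 0 * T 1 * T 0.
Proof. by move=> n2; exact: palg_braid4 (AKBraid0 l Q q n2). Qed.

Lemma ak_comm0 j : (1 < j < n)%N -> T 0 * T j = T j * T 0.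
Proof. by move=> jn; exact: palg_comm (@AKComm _ l n Q q 0 j jn). Qed.

Lemma ak_gen_inv j : (1 <= j < n)%N -> q \is a GRing.unit ->
  let t := cst q^-1 * (T j + cst (1 - q)) in t * T j = 1 /\ T j * t = 1.
Proof.
move=> jn qU; rewrite ak_cstD ak_cstN ak_cst1.
apply: (quadratic_inverse (ak_quadratic jn)); [| exact: ak_cstC | exact: ak_cstC].
by rewrite -ak_cstM mulVr.
Qed.

End ArikiKoikeRelations.

Section JucysMurphy.
Variables (l p n : nat) (rs : (l %/ p).-tuple int) (r : int).
Hypotheses (p_gt0 : (0 < p)%N) (n_ge2 : (2 <= n)%N).
Variable iota : {rmorphism cyc_hecke n rs r -> cyc_ak n rs r}.
Hypothesis hiota : hecke_in_ak iota.

Local Notation q := (cycq l p r).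
Local Notation T := (cyc_ak_gen n rs r).
Local Notation cst := (cyc_ak_cst n rs r).

Definition in_im (x : cyc_ak n rs r) : Prop := exists h, iota h = x.

Lemma in_imD x y : in_im x -> in_im y -> in_im (x + y).
Proof. by move=> [h <-] [k <-]; exists (h + k); rewrite rmorphD. Qed.

Lemma in_imM x y : in_im x -> in_im y -> in_im (x * y).
Proof. by move=> [h <-] [k <-]; exists (h * k); rewrite rmorphM. Qed.

Lemma in_im_cst (a : laurent l) : in_im (cst (val a)).
Proof. by case: hiota => e _ _ _; exists (cyc_cst n rs r a); rewrite e. Qed.

Lemma in_im_gen j : (1 <= j < n)%N -> in_im (T j).
Proof.
move=> /andP[j1 jn]; case: hiota => _ _ _ e; exists (cyc_gen n rs r j.+1).
by rewrite e // ltnS j1.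
Qed.

Lemma in_im_gen0X : in_im (T 0 ^+ p).
Proof. by case: hiota => _ e _ _; exists (cyc_gen n rs r 0). Qed.

Lemma val_lmonom a e : val (lmonom l a e) = kcst (zetaK l ^+ a) * yvar l ^ e.
Proof. by []. Qed.

Lemma val_lmonom0 e : val (lmonom l 0 e) = yvar l ^ e.
Proof. by rewrite val_lmonom expr0 /kcst tofrac1 mul1r. Qed.

Lemma q_unit : q \is a GRing.unit.
Proof. by rewrite /cycq unitfE expfz_neq0 // yvar_neq0. Qed.

Lemma in_im_qV : in_im (cst q^-1).
Proof. by rewrite /cycq invr_expz -val_lmonom0; exact: in_im_cst. Qed.

Lemma gen_inv j : (1 <= j < n)%N -> exists2 t, in_im t & t * T j = 1 /\ T j * t = 1.
Proof.
move=> jn; exists (cst q^-1 * (T j + cst (1 - q))); last exact: ak_gen_inv jn q_unit.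
apply: in_imM; first exact: in_im_qV.
apply: in_imD; first exact: in_im_gen.
have -> : 1 - q = val (1 - lmonom l 0 (p%:Z * r)).
  by rewrite [RHS]rmorphB rmorph1 /cycq -val_lmonom0.
exact: in_im_cst.
Qed.

Variable u : cyc_ak n rs r.
Hypotheses (uT : u * T 0 = 1) (Tu : T 0 * u = 1).
Hypothesis iota1 : iota (cyc_gen n rs r 1) = u * T 1 * T 0.


Lemma pgenE (g : 'I_n.+1) :
  pgen (@hecke_rel _ p (l %/ p) n (phiX rs) (phix l p r)) g = cyc_gen n rs r g.
Proof. by rewrite /cyc_gen /hecke_gen inord_val. Qed.

Lemma in_im_conj_gen j : (j <= n)%N -> in_im (T 0 * iota (cyc_gen n rs r j) * u).
Proof.
move=> jn; case: (hiota) => _ e0 _ ej.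
have [j0|[j1|[j2|j3]]] : (j = 0 \/ j = 1 \/ j = 2 \/ 3 <= j)%N by lia.
- rewrite j0 e0 (conj_pow p Tu); exact: in_im_gen0X.
- by rewrite j1 iota1 (conjK _ Tu); exact: in_im_gen.
- rewrite j2 ej ?n_ge2 //=.
  have n1 : (1 <= 1 < n)%N by rewrite n_ge2.
  have [t tim [tT Tt]] := gen_inv n1.
  rewrite (conj_braid uT Tu tT (@ak_braid _ l n (cycQ rs) q n_ge2)).
  apply: in_imM; last exact: in_im_gen.
  by apply: in_imM => //; rewrite -iota1; exists (cyc_gen n rs r 1).
rewrite ej; last by lia.
rewrite (conj_comm Tu); first by apply: in_im_gen; lia.
by apply: ak_comm0; lia.
Qed.

(** T_0 normalises the image, by a check on generators; so the Ariki-Koike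
    algebra is graded modulo p by powers of T_0, with the image as its part of
    degree 0. *)
Lemma in_im_conj x : in_im x -> in_im (T 0 * x * u).
Proof.
case=> h <-{x}; move: h; apply: palg_ind => [a|g|x y hx hy|x y hx hy].
- case: (hiota) => /(_ a) e _ _ _.
  have -> : iota (pcst _ a) = cst (val a) by exact: e.
  rewrite (conj_comm Tu); first exact: in_im_cst.
  exact/esym/ak_cstC.
- by rewrite pgenE; apply: in_im_conj_gen; rewrite -ltnS.
- rewrite rmorphD mulrDr mulrDl; exact: in_imD.
rewrite rmorphM (conj_mul _ _ uT); exact: in_imM.
Qed.

Local Notation L := (jucys_murphy l n (cycQ rs) q).
Local Notation in_deg := (in_deg in_im u).

Lemma in_im1 : in_im 1.
Proof. by exists 1; rewrite rmorph1. Qed.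

Lemma jucys_murphy_deg k : (k < n)%N -> in_deg 1 (L k).
Proof.
have M := in_degM uT in_imM in_im_conj.
elim: k => [_|k IH kn].
  rewrite /in_deg expr1 [L 0]/= Tu; exact: in_im1.
have Tk : in_deg 0 (T k.+1) by rewrite /in_deg mulr1; apply: in_im_gen.
have qV : in_deg 0 (cst q^-1) by rewrite /in_deg mulr1; exact: in_im_qV.
exact: M (M _ _ _ _ (M _ _ _ _ qV Tk) (IH (ltnW kn))) Tk.
Qed.

Lemma jm_psum_im s : (p %| sumn s)%N ->
  in_im (\prod_(a <- s) \sum_(k < n) L k ^+ a).
Proof.
have im0 : in_im 0 by exists 0; rewrite rmorph0.
apply: (prod_psum_Im uT im0 in_im1 in_imD in_imM in_im_conj in_im_gen0X) => k.
exact: jucys_murphy_deg.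
Qed.

End JucysMurphy.

(** * The root of unity of least argument is primitive *)

(** Rotating x by the smaller angle of t moves it towards 1. *)
Lemma Re_rotation_lt (C : numClosedFieldType) (x t : C) :
  `|x| = 1 -> `|t| = 1 -> 0 <= 'Im x -> 0 <= 'Im t -> t != 1 ->
  'Re x <= 'Re t -> 'Re x < 'Re (x * t^*).
Proof.
move=> nx nt vge0 sge0 t1; have := normC2_Re_Im x; have := normC2_Re_Im t.
rewrite nx nt !expr1n ReM Re_conj Im_conj mulrN opprK.
have aR : 'Re t \is Num.real by exact: Creal_Re.
have bR : 'Re x \is Num.real by exact: Creal_Re.
have a1 : 'Re t < 1.
  have [le1 eq1] := leif_Re_Creal t; rewrite nt in le1 eq1.
  rewrite lt_neqAle le1 andbT eq1; apply: contra t1 => t0.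
  by rewrite -(ger0_norm t0) nt.
move: vge0 sge0 aR bR a1; move: ('Re x) ('Im x) ('Re t) ('Im t) => b v a s.
move=> vge0 sge0 aR bR a1 as1 bv1 ba.
rewrite -subr_gt0; have -> : b * a + v * s - b = v * s - b * (1 - a) by ring.
rewrite subr_gt0.
have a1' : 0 < 1 - a by rewrite subr_gt0.
have : (b < 0) || (b == 0) || (0 < b).
  by case: (real_ltgt0P bR) => // ->; rewrite eqxx.
case/orP=> [/orP[b0|/eqP b0]|b0].
- apply: lt_le_trans (mulr_ge0 vge0 sge0).
  by rewrite nmulr_rlt0.
- subst b; rewrite mul0r lt_neqAle mulr_ge0 // andbT eq_sym mulf_eq0 negb_or.
  apply/andP; split.
    by apply/eqP => v0; move/eqP: bv1; rewrite v0 !expr0n /= addr0 oner_eq0.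
  apply/eqP => s0; move/eqP: as1; rewrite s0 expr0n addr0 eq_sym.
  by rewrite sqrf_eq1 (lt_eqF a1) /= => /eqP am1; move: ba; rewrite am1 oppr_ge0 ler10.
have b1 : b < 1 by exact: le_lt_trans ba a1.
rewrite -(@ltr_pXn2r _ 2) ?nnegrE ?mulr_ge0 ?(ltW b0) ?(ltW a1') //.
rewrite -subr_gt0 !exprMn.
have -> : v ^+ 2 = 1 - b ^+ 2 by rewrite bv1 addrC addKr.
have -> : s ^+ 2 = 1 - a ^+ 2 by rewrite as1 addrC addKr.
have -> : (1 - b ^+ 2) * (1 - a ^+ 2) - b ^+ 2 * (1 - a) ^+ 2
   = (1 - a) * ((1 - b ^+ 2) + (a - b ^+ 2)) by ring.
have b2 : b ^+ 2 < b by rewrite expr2 gtr_pMr.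
rewrite mulr_gt0 // addr_gt0 // subr_gt0; first exact: lt_trans b2 b1.
exact: lt_le_trans b2 ba.
Qed.

Section LeastArgument.
Variables (l : nat) (l_gt1 : (1 < l)%N).
Let u : algC := l.-root (-1).
Let N := (l * 2)%N.
Let l_gt0 : (0 < l)%N := ltnW l_gt1.

Let uXl : u ^+ l = -1. Proof. exact: rootCK. Qed.
Let uXN : u ^+ N = 1. Proof. by rewrite exprM uXl sqrrN expr1n. Qed.
Let Im_u : 0 <= 'Im u. Proof. exact: Im_rootC_ge0. Qed.
Let N_gt0 : (0 < N)%N. Proof. by rewrite muln_gt0 l_gt0. Qed.
Let u_neq1 : u != 1.
Proof.
by apply/eqP => u1; have /eqP := uXl; rewrite u1 expr1n -addr_eq0 (pnatr_eq0 _ 2).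
Qed.

Let norm1 (x : algC) : x ^+ N = 1 -> `|x| = 1.
Proof.
move=> xN; apply/eqP; rewrite -(@pexpr_eq1 _ _ N) ?normr_ge0 // -?lt0n //.
by rewrite -normrX xN normr1.
Qed.
Let norm_conj (x : algC) : x ^+ N = 1 -> x * x^* = 1.
Proof. by move=> xN; rewrite -normCK norm1 // expr1n. Qed.

Let Re_root_max (y : algC) : y ^+ l = -1 -> 'Re y <= 'Re u.
Proof.
move=> yl; have := Creal_Im y; case/real_ge0P => [/(rootC_Re_max l_gt0 yl)//|Im_lt0].
rewrite -Re_conj; apply: rootC_Re_max => //; first by rewrite -rmorphXn yl rmorphN1.
by rewrite Im_conj oppr_ge0 ltW.
Qed.

(** Otherwise u / t or its conjugate would be a root of -1 with a larger real
    part than u. *)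
Let Re_le (t : algC) : t ^+ N = 1 -> t != 1 -> 0 <= 'Im t -> 'Re t <= 'Re u.
Proof.
move=> tN t1 It; have := tN; rewrite /N mulnC exprM => /eqP.
have := tN; rewrite /N exprM => /eqP; rewrite sqrf_eq1 => /orP[/eqP tl _|/eqP tl _]; last first.
  exact: Re_root_max.
rewrite real_leNgt ?Creal_Re //; apply/negP => ut.
have := Re_rotation_lt (norm1 uXN) (norm1 tN) Im_u It t1 (ltW ut).
rewrite real_ltNge ?Creal_Re // Re_root_max // exprMn uXl -rmorphXn tl rmorph1.
by rewrite mulr1.
Qed.

(** As long as x is not 1, dividing x or its conjugate by u increases the real
    part, which can only happen finitely often. *)
Let power_of_u (x : algC) : x ^+ N = 1 -> exists j, x = u ^+ j.
Proof.
have [w w_prim] := C_prim_root_exists N_gt0.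
pose rs := [seq w ^+ i | i <- iota 0 N].
have rsP y : y ^+ N = 1 -> y \in rs.
  by move=> yN; have [i ->] := prim_rootP w_prim yN; apply: map_f; rewrite mem_iota /=.
pose m y := count (fun z => 'Re y < 'Re z) rs.
have [k] := ubnP (m x); elim: k x => // k IH x.
have conjN y : y ^+ N = 1 -> (y^*) ^+ N = 1 by move=> yN; rewrite -rmorphXn yN rmorph1.
have conj_pow y : (exists j, y = u ^+ j) -> exists j, y^* = u ^+ j.
  case=> j ->; exists (N.-1 * j)%N.
  have -> : (u ^+ j)^* = (u ^+ N.-1) ^+ j.
    rewrite rmorphXn; congr (_ ^+ _).
    rewrite -[LHS]mul1r -uXN -(prednK N_gt0) exprSr -mulrA norm_conj // mulr1.
    by rewrite (prednK N_gt0).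
  by rewrite exprM.
wlog Ix : x / 0 <= 'Im x => [W|] mx xN.
  have := Creal_Im x; case/real_ge0P => [Ix|Im_lt0]; first exact: W.
  rewrite -[x]conjCK; apply: conj_pow; apply: W; rewrite ?conjN //.
    by rewrite Im_conj oppr_ge0 ltW.
  by rewrite /m Re_conj.
have [->|x1] := eqVneq x 1; first by exists 0%N.
have xu := Re_rotation_lt (norm1 xN) (norm1 uXN) Ix Im_u u_neq1 (Re_le xN x1 Ix).
have xuN : (x * u^*) ^+ N = 1 by rewrite exprMn xN conjN // mulr1.
have [|j xj] := IH (x * u^*) _ xuN.
  rewrite ltnS in mx; apply: leq_trans mx.
  have := rsP _ xuN; rewrite /m; move: (rs); elim=> //= z s IHs; rewrite inE.
  have le : (count (fun z => ('Re (x * u^*) < 'Re z)%R) s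
             <= count (fun z => ('Re x < 'Re z)%R) s)%N.
    by apply: sub_count => y; exact: lt_trans.
  move=> /orP[/eqP <-|/IHs lt]; first by rewrite ltxx xu add0n add1n ltnS.
  have h : ('Re (x * u^*) < 'Re z -> 'Re x < 'Re z)%R by exact: lt_trans.
  rewrite -addnS leq_add //; move: h.
  by case: ('Re (x * u^*) < 'Re z)%R => // ->.
by exists j.+1; rewrite exprSr -xj -mulrA [u^* * u]mulrC norm_conj // mulr1.
Qed.

Lemma rootN1_primitive : N.-primitive_root u.
Proof.
have [w w_prim] := C_prim_root_exists N_gt0.
have [j wj] := power_of_u (prim_expr_order w_prim).
have [m m_prim mN] := prim_order_exists N_gt0 uXN.
have wm : w ^+ m = 1 by rewrite wj exprAC (prim_expr_order m_prim) expr1n.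
suff <- : m = N by [].
by apply/eqP; rewrite eqn_dvd mN (prim_order_dvd w_prim) wm eqxx.
Qed.

End LeastArgument.

Lemma zeta_primitive l : (0 < l)%N -> l.-primitive_root (zeta l).
Proof.
case: l => [//|[_|l _]].
  rewrite /zeta root1C sqrrN expr1n; apply/andP; split=> //.
  by apply/forallP => i; rewrite ord1 /= unity_rootE expr1n !eqxx.
have := dvdn_prim_root (@rootN1_primitive l.+2 isT) (dvdn_mulr 2 (dvdnn l.+2)).
by rewrite mulKn.
Qed.

Local Notation "x %:F" := (FracField.tofrac x) : ring_scope.

(** * Valuations *)

Lemma frac_repr (R : idomainType) (x : {fraction R}) :
  x * (\d_(repr x))%:F = (\n_(repr x))%:F.
Proof.
rewrite -{1}[x]reprK; move: (repr x) => y; unlock FracField.tofrac.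
rewrite -[LHS]FracField.pi_mul; apply/eqmodP.
rewrite /= FracField.equivfE /FracField.mulf !numden_Ratio ?mulf_neq0 ?oner_eq0 ?denom_ratioP //.
by rewrite !mulr1 mulrC.
Qed.

Lemma frac_numden (R : idomainType) (x : {fraction R}) :
  x = (\n_(repr x))%:F / (\d_(repr x))%:F.
Proof. by rewrite -frac_repr mulfK // tofrac_eq0 denom_ratioP. Qed.

Lemma numer_neq0 (R : idomainType) (x : {fraction R}) : x != 0 -> \n_(repr x) != 0.
Proof. by apply: contra => /eqP e; rewrite [x]frac_numden e tofrac0 mul0r. Qed.

Lemma frac_cross (R : idomainType) (g h : R) (x : {fraction R}) :
  h != 0 -> x = g%:F / h%:F -> \n_(repr x) * h = g * \d_(repr x).
Proof.
move=> h0 xE; apply/eqP; rewrite -tofrac_eq !tofracM -frac_repr {1}xE mulrAC.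
by rewrite divfK // tofrac_eq0.
Qed.

Lemma frac_neq0 (R : idomainType) (g h : R) : g != 0 -> h != 0 -> g%:F / h%:F != 0.
Proof. by move=> g0 h0; rewrite mulf_neq0 ?invr_eq0 ?tofrac_eq0. Qed.

Lemma frac_mul (R : idomainType) (x y : {fraction R}) : x * y =
  (\n_(repr x) * \n_(repr y))%:F / (\d_(repr x) * \d_(repr y))%:F.
Proof. by rewrite {1}[x]frac_numden {1}[y]frac_numden mulf_div -!tofracM. Qed.

Lemma horner_map_binomial (R S : comNzRingType) (f : {rmorphism R -> S}) a b k x :
  (map_poly f (a *: 'X^k + b%:P)).[x] = f a * x ^+ k + f b.
Proof. by rewrite rmorphD /= map_polyZ map_polyXn map_polyC !hornerE. Qed.

Lemma horner_map_deriv_binomial (R S : comNzRingType) (f : {rmorphism R -> S}) a b k x :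
  (map_poly f (a *: 'X^k + b%:P)^`()).[x] = f a * (x ^+ k.-1 *+ k).
Proof.
rewrite derivD derivC addr0 derivZ derivXn /= map_polyZ rmorphMn /= map_polyXn.
by rewrite hornerZ hornerMn hornerXn.
Qed.

Lemma Qadj_val_eq0 (s : seq algC) (a : Qadj s) : (val a == 0) = (a == 0).
Proof. by rewrite -(rmorph0 (val : Qadj s -> algC)) (inj_eq val_inj). Qed.

Section ValuationTheory.
Variables (F : fieldType) (v : F -> int).
Hypotheses (v1 : v 1 = 0) (vM : forall x y, x != 0 -> y != 0 -> v (x * y) = v x + v y).

Lemma val_inv x : x != 0 -> v x^-1 = - v x.
Proof.
by move=> x0; apply: (addIr (v x)); rewrite -vM ?invr_eq0 // mulVf // v1 addNr.
Qed.

Lemma val_exp x k : x != 0 -> v (x ^+ k) = v x *+ k.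
Proof.
move=> x0; elim: k => [|k IH]; first by rewrite v1.
by rewrite exprS vM ?expf_neq0 // IH mulrS.
Qed.

Lemma val_prod (I : Type) (s : seq I) (P : pred I) (X : I -> F) :
  (forall i, P i -> X i != 0) ->
  v (\prod_(i <- s | P i) X i) = \sum_(i <- s | P i) v (X i).
Proof.
move=> X0; elim: s => [|i s IH]; first by rewrite !big_nil.
rewrite !big_cons; case: ifP => [Pi|//]; rewrite vM ?IH ?X0 //.
apply: (big_ind (fun z => z != 0)) => //; [exact: oner_neq0 | exact: mulf_neq0].
Qed.

End ValuationTheory.

Section Valuation.
Variables (l : nat) (eta : algC) (Phi : {poly cyclo l}).
Hypothesis hPhi : is_minpoly eta Phi.
Local Notation K := (cyclo l).
Local Notation Ky := (cycloy l).
Implicit Types (g h : {poly K}) (x : Ky).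

Lemma minpoly_dvd g : (Phi %| g) = root (map_poly val g) eta.
Proof. by case: hPhi => _ ->. Qed.

Lemma minpoly_dvdM g h : (Phi %| g * h) = (Phi %| g) || (Phi %| h).
Proof. by rewrite !minpoly_dvd rmorphM rootM. Qed.

Lemma minpoly_neq0 : Phi != 0.
Proof. by apply: monic_neq0; case: hPhi. Qed.

Lemma minpoly_ndvd_const (a : K) : a != 0 -> ~~ (Phi %| a%:P).
Proof. by move=> a0; rewrite minpoly_dvd map_polyC /= rootC Qadj_val_eq0. Qed.

Lemma size_minpoly : (1 < size Phi)%N.
Proof.
rewrite ltnNge; apply/negP => /size1_polyC e.
have := dvdpp Phi; rewrite {2}e; apply/negP/minpoly_ndvd_const.
by apply: contraNneq minpoly_neq0 => e0; rewrite e e0.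
Qed.

Lemma poly_mult_unique k g : ~~ (Phi %| g) -> poly_mult Phi (Phi ^+ k * g) = k.
Proof.
move=> gN; apply/eqP; rewrite eqn_leq; apply/andP; split.
  apply/bigmax_leqP => i iP; rewrite leqNgt; apply: contra gN => ki.
  have : Phi ^+ k.+1 %| Phi ^+ k * g by apply: dvdp_trans iP; exact: dvdp_exp2l.
  by rewrite exprSr dvdp_mul2l // expf_neq0 // minpoly_neq0.
have g0 : g != 0 by apply: contraNneq gN => ->; rewrite dvdp0.
have ks : (k < size (Phi ^+ k * g)%R)%N.
  apply: leq_trans (dvdp_leq _ (dvdp_mulr g (dvdpp _))); last first.
    by rewrite mulf_neq0 // expf_neq0 // minpoly_neq0.
  rewrite -[size _]prednK ?lt0n ?size_poly_eq0 ?expf_neq0 ?minpoly_neq0 // ltnS.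
  by rewrite size_exp leq_pmull // -ltnS prednK ?size_minpoly // (ltn_trans _ size_minpoly).
exact: (@leq_bigmax_cond _ _ _ (Ordinal ks) (dvdp_mulr g (dvdpp _))).
Qed.

Lemma poly_mult_decomp g : g != 0 ->
  exists h, ~~ (Phi %| h) /\ g = Phi ^+ poly_mult Phi g * h.
Proof.
move=> g0; suff [k [h [hN gE]]] : exists k h, ~~ (Phi %| h) /\ g = Phi ^+ k * h.
  by exists h; rewrite {2}gE poly_mult_unique.
have [m] := ubnP (size g); elim: m g g0 => // m IH g g0 sg.
have [/dvdpP[h gE]|gN] := boolP (Phi %| g); last by exists 0%N, g; rewrite mul1r.
have h0 : h != 0 by apply: contraNneq g0 => h0; rewrite gE h0 mul0r.
have [|k [h' [h'N hE]]] := IH h h0.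
  have h1 : (0 < size h)%N by rewrite size_poly_gt0.
  move: sg h1 size_minpoly; rewrite gE size_mul ?minpoly_neq0 //.
  by move: (size h) (size Phi) => b c; lia.
by exists k.+1, h'; split=> //; rewrite gE hE exprS; ring.
Qed.

Lemma poly_multM g h : g != 0 -> h != 0 ->
  poly_mult Phi (g * h) = (poly_mult Phi g + poly_mult Phi h)%N.
Proof.
move=> /poly_mult_decomp [g' [g'N gE]] /poly_mult_decomp [h' [h'N hE]].
rewrite {1}gE {1}hE mulrACA -exprD poly_mult_unique //.
by rewrite minpoly_dvdM negb_or g'N.
Qed.

Lemma poly_mult_ndvd g : ~~ (Phi %| g) -> poly_mult Phi g = 0%N.
Proof. by move=> gN; rewrite -[g]mul1r -(expr0 Phi) poly_mult_unique. Qed.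

Lemma nu_frac g h : g != 0 -> h != 0 ->
  nu Phi (g%:F / h%:F) = (poly_mult Phi g)%:Z - (poly_mult Phi h)%:Z.
Proof.
move=> g0 h0; rewrite /nu; have := frac_cross h0 (erefl (g%:F / h%:F)).
have := numer_neq0 (frac_neq0 g0 h0); have := denom_ratioP (repr (g%:F / h%:F)).
move: (\n_ _) (\d_ _) => N D D0 N0 /(congr1 (poly_mult Phi)).
rewrite !poly_multM //; lia.
Qed.

Lemma nuM x y : x != 0 -> y != 0 -> nu Phi (x * y) = nu Phi x + nu Phi y.
Proof.
move=> /numer_neq0 x0 /numer_neq0 y0; rewrite frac_mul.
have dx := denom_ratioP (repr x); have dy := denom_ratioP (repr y).
rewrite nu_frac ?mulf_neq0 // !poly_multM // /nu.
move: (poly_mult _ _) (poly_mult _ _) (poly_mult _ _) (poly_mult _ _); lia.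
Qed.

Lemma nu_poly g : g != 0 -> nu Phi g%:F = (poly_mult Phi g)%:Z.
Proof.
move=> g0; rewrite -[g%:F]divr1 -tofrac1 nu_frac ?oner_eq0 //.
by rewrite (@poly_mult_ndvd 1) ?subr0 // -polyC1 minpoly_ndvd_const // oner_eq0.
Qed.

Lemma nu1 : nu Phi 1 = 0.
Proof. by apply: (addIr (nu Phi 1)); rewrite -nuM ?oner_eq0 // mulr1 add0r. Qed.

Lemma nuV x : x != 0 -> nu Phi x^-1 = - nu Phi x.
Proof. exact: val_inv nu1 nuM x. Qed.

Lemma nuX x k : x != 0 -> nu Phi (x ^+ k) = nu Phi x *+ k.
Proof. exact: val_exp nu1 nuM x k. Qed.

Lemma nu_kcst (a : K) : a != 0 -> nu Phi (kcst a) = 0.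
Proof.
by move=> a0; rewrite nu_poly ?polyC_eq0 // poly_mult_ndvd // minpoly_ndvd_const.
Qed.

Hypothesis eta_neq0 : eta != 0.

Lemma nu_yvar : nu Phi (yvar l) = 0.
Proof.
rewrite nu_poly ?polyX_eq0 // poly_mult_ndvd // minpoly_dvd map_polyX rootX.
exact: eta_neq0.
Qed.

Lemma nu_yvarX e : nu Phi (yvar l ^ e) = 0.
Proof.
have y0 := yvar_neq0 l.
case: e => k; rewrite ?NegzE -?exprnN ?nuV ?expf_neq0 // nuX // nu_yvar mul0rn //.
Qed.

(** The binomial is separable: its derivative is a monomial, nonzero at eta. *)
Lemma poly_mult_binomial (a b : K) k : (0 < k)%N -> a != 0 -> b != 0 ->
  poly_mult Phi (a *: 'X^k + b%:P) = (val a * eta ^+ k + val b == 0).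
Proof.
move=> k0 a0 b0; set g := _ + _.
have ev : (val a * eta ^+ k + val b == 0) = (Phi %| g).
  by rewrite minpoly_dvd /root (horner_map_binomial (val : {rmorphism K -> algC})).
rewrite ev; have [Pg|gN] := boolP (Phi %| g); last exact: poly_mult_ndvd.
have g0 : g != 0.
  apply/eqP => /(congr1 (horner^~ 0)); rewrite !hornerE expr0n eqn0Ngt k0 mulr0 add0r.
  by apply/eqP.
have [h [hN gE]] := poly_mult_decomp g0.
case: (poly_mult Phi g) gE => [|[|m]] gE //.
  by rewrite gE mul1r (negbTE hN) in Pg.
have : Phi %| g^`().
  rewrite gE !exprS derivM derivM dvdp_add //; last by rewrite dvdp_mulr // dvdp_mulr.
  rewrite dvdp_mulr // dvdp_add //; first by rewrite dvdp_mull // dvdp_mulr.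
  by rewrite dvdp_mulr.
rewrite minpoly_dvd /root (horner_map_deriv_binomial (val : {rmorphism K -> algC})).
rewrite mulf_eq0 Qadj_val_eq0 (negbTE a0) /=.
by rewrite mulrn_eq0 eqn0Ngt k0 /= expf_eq0 (negbTE eta_neq0) andbF.
Qed.

Lemma kcstB1 (a : K) : kcst a - 1 = kcst (a - 1).
Proof. by rewrite /kcst polyCB tofracB polyC1 tofrac1. Qed.

Lemma nu_monomial_sub1 (a : K) e : a != 0 -> kcst a * yvar l ^ e != 1 ->
  nu Phi (kcst a * yvar l ^ e - 1) = (val a * eta ^ e == 1)%:R.
Proof.
move=> a0; have y0 := yvar_neq0 l; case: e => [[|k]|k].
- rewrite !expr0z !mulr1 kcstB1 -subr_eq0 kcstB1 /kcst tofrac_eq0 polyC_eq0 => a1.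
  rewrite nu_kcst // -(rmorph1 (val : K -> algC)) (inj_eq val_inj) -subr_eq0.
  by rewrite (negbTE a1).
- move=> _; have -> : kcst a * yvar l ^ k.+1 - 1 = (a *: 'X^(k.+1) + (-1)%:P)%:F.
    by rewrite /kcst /yvar -mul_polyC tofracD tofracM tofracXn polyCN tofracN polyC1 tofrac1.
  have N1 : (-1 : K) != 0 by rewrite oppr_eq0 oner_eq0.
  have nz : a *: 'X^(k.+1) + (-1)%:P != 0.
    apply/eqP => /(congr1 (horner^~ 0)); rewrite !hornerE expr0n mulr0 add0r.
    by apply/eqP.
  rewrite nu_poly // poly_mult_binomial // rmorphN rmorph1 subr_eq0.
  by case: eqP.
move=> _; have -> : kcst a * yvar l ^ Negz k - 1
    = (-1 *: 'X^(k.+1) + a%:P)%:F / yvar l ^+ k.+1.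
  rewrite NegzE -exprnN; apply: (mulIf (expf_neq0 k.+1 y0)).
  rewrite mulrBl mul1r !mulfVK ?expf_neq0 //.
  by rewrite scaleN1r tofracD tofracN tofracXn addrC.
have N1 : (-1 : K) != 0 by rewrite oppr_eq0 oner_eq0.
have nz : -1 *: 'X^(k.+1) + a%:P != 0.
  apply/eqP => /(congr1 (horner^~ 0)); rewrite !hornerE expr0n mulr0 add0r.
  by apply/eqP.
rewrite nuM ?tofrac_eq0 ?invr_eq0 ?expf_neq0 // nuV ?expf_neq0 // nuX // nu_yvar.
rewrite mul0rn subr0 nu_poly // poly_mult_binomial // rmorphN rmorph1 mulN1r.
rewrite addrC subr_eq0 NegzE -exprnN -[in RHS](inj_eq (mulIf (expf_neq0 k.+1 eta_neq0))).
by rewrite mulfVK ?expf_neq0 // mul1r; case: eqP.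
Qed.

End Valuation.

(** * Nodes of multipartitions *)

Section Nodes.
Variables l n : nat.
Implicit Types lam mu : mpart l n.

Lemma size_component lam a : size (component lam a) = n.
Proof. by rewrite size_map size_tuple. Qed.

Lemma sorted_component lam a : sorted geq (component lam a).
Proof. by case/andP: (valP lam) => /forallP/(_ a). Qed.

Lemma row_len_le lam a i : (row_len (component lam a) i <= n)%N.
Proof.
rewrite /row_len; have [ni|lt] := leqP n i; first by rewrite nth_default ?size_component.
have : nth 0%N (component lam a) i \in component lam a by rewrite mem_nth ?size_component.
by case/mapP => k _ ->; rewrite -ltnS.
Qed.

Definition nodes lam : {set 'I_l * 'I_n * 'I_n} :=
  [set x : 'I_l * 'I_n * 'I_n | (x.2 < row_len (component lam x.1.1) x.1.2)%N].

Lemma sum_nodes (M : zmodType) lam (g : 'I_l -> nat -> nat -> M) :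
  \sum_(x in nodes lam) g x.1.1 x.1.2 x.2 =
  \sum_a \sum_(i < n) \sum_(j < row_len (component lam a) i) g a i j.
Proof.
transitivity (\sum_a \sum_(i < n) \sum_(j < n | (j < row_len (component lam a) i)%N) g a i j).
  rewrite pair_bigA pair_big_dep /=; apply: eq_big => [[[a i] j]|[[a i] j] _] //=.
  by rewrite inE.
apply: eq_bigr => a _; apply: eq_bigr => i _.
by rewrite -(big_ord_widen _ (fun j => g a i j)) // row_len_le.
Qed.

Lemma sum_nodes_int lam (g : 'I_l -> nat -> nat -> int) :
  \sum_(x in nodes lam) g x.1.1 x.1.2 x.2 =
  \sum_a node_sum (component lam a) (g a).
Proof. by rewrite sum_nodes; apply: eq_bigr => a _; rewrite /node_sum size_component. Qed.

Lemma sumn_row_len (s : seq nat) : sumn s = (\sum_(i < size s) row_len s i)%N.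
Proof.
by rewrite sumnE (big_nth 0%N) big_mkord.
Qed.

Lemma card_nodes_component lam a :
  #|[set x in nodes lam | x.1.1 == a]| = sumn (component lam a).
Proof.
rewrite sumn_row_len size_component -sum1_card.
apply/eqP; rewrite -(eqr_nat int) !natr_sum; apply/eqP.
transitivity (\sum_(x in nodes lam) (if x.1.1 == a then 1%:R else 0) : int).
  by rewrite -big_mkcondr; apply: eq_bigl => x; rewrite inE.
rewrite (sum_nodes _ (fun a' _ _ => if a' == a then 1%:R else 0)) (bigD1 a) //= eqxx.
rewrite [X in _ + X]big1 ?addr0 => [|b /negbTE ->]; last first.
  by rewrite big1 // => i _; rewrite big1.
by apply: eq_bigr => i _; rewrite sumr_const card_ord.
Qed.

Lemma card_nodes lam : #|nodes lam| = n.
Proof.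
case/andP: (valP lam) => _ /eqP e; rewrite -[RHS]e -sum1_card.
rewrite (partition_big (fun x => x.1.1) predT) //=.
apply: eq_bigr => a _; rewrite -card_nodes_component -sum1_card.
by apply: eq_bigl => x; rewrite inE.
Qed.

(** A standard tableau is injective and there are n nodes. *)
Lemma sum_std_tab (M : zmodType) lam (t : std_tab lam) (g : 'I_l * 'I_n * 'I_n -> M) :
  \sum_k g (val t k) = \sum_(x in nodes lam) g x.
Proof.
have /and3P[/injectiveP tinj /forallP tnode _] := valP t.
have -> : nodes lam = [set val t k | k in 'I_n].
  apply/esym/eqP; rewrite eqEcard card_imset // card_ord card_nodes leqnn andbT.
  apply/subsetP => x /imsetP[k _ ->]; rewrite inE.
  by move: (tnode k); case: (val t k) => [[a i] j].
by rewrite big_imset /= => [|k1 k2 _ _ /tinj //]; apply: eq_bigl.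
Qed.

Lemma sorted_row_len (s : seq nat) i k : sorted geq s -> (i <= k)%N ->
  (row_len s k <= row_len s i)%N.
Proof.
have tr : transitive geq by move=> a b c /= ba ac; exact: leq_trans ac ba.
move=> ss ik; rewrite /row_len; have [sk|ks] := leqP (size s) k.
  by rewrite nth_default.
have := sorted_leq_nth tr (fun x => leqnn x) 0%N ss.
by move=> /(_ i k); rewrite !inE ks (leq_ltn_trans ik ks) => /(_ isT isT ik).
Qed.

Lemma hook_gt0 (s : seq nat) i j : sorted geq s -> (i < size s)%N ->
  (j < row_len s i)%N -> 0 < hook s s i j.
Proof.
move=> ss ilt jlt; have : (i < col_len s j)%N.
  rewrite /col_len -(cat_take_drop i.+1 s) count_cat.
  have -> : count (leq j.+1) (take i.+1 s) = i.+1.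
    rewrite -[RHS](size_takel ilt); apply/eqP; rewrite -all_count.
    apply/(all_nthP 0%N) => k; rewrite size_takel // => ki.
    by rewrite nth_take //; apply: leq_trans jlt _; exact: sorted_row_len.
  exact: leq_addr.
rewrite /hook; move: jlt; lia.
Qed.

(** In the first row where two partitions differ, the first node of only one
    of them is on a diagonal that the other one does not meet any more. *)
Lemma contents_determine (s1 s2 : seq nat) : size s1 = size s2 ->
  sorted geq s1 -> sorted geq s2 ->
  (forall c : int, node_sum s1 (fun i j => (j%:Z - i%:Z == c)%:R)
                 = node_sum s2 (fun i j => (j%:Z - i%:Z == c)%:R)) ->
  s1 = s2.
Proof.
move=> sz ss1 ss2 H; apply: (@eq_from_nth _ 0%N _ _ sz) => i; elim/ltn_ind: i => i IH ilt.
wlog lt : s1 s2 sz ss1 ss2 H IH ilt / (row_len s2 i < row_len s1 i)%N.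
  move=> W; have [lt|lt|//] := ltngtP (nth 0%N s1 i) (nth 0%N s2 i).
    apply/esym; apply: (W s2 s1) => //; last by rewrite -sz.
    by move=> k ki; rewrite -sz => klt; rewrite (IH k ki klt).
  exact: (W s1 s2).
exfalso; set m := row_len s2 i in lt; pose c := m%:Z - i%:Z.
pose row (s : seq nat) (k : nat) : int := \sum_(j < row_len s k) (j%:Z - k%:Z == c)%:R.
have row_ge0 s k : 0 <= row s k by apply: sumr_ge0 => j _; case: eqP.
have row2 k : (i <= k)%N -> row s2 k = 0.
  move=> ik; apply: big1 => j _; case: eqP => // e.
  have jm : (j < m)%N by apply: leq_trans (ltn_ord j) _; exact: sorted_row_len.
  move: e jm ik; rewrite /c; lia.
have row1 : 1 <= row s1 i.
  rewrite /row (bigD1 (Ordinal lt)) //= eqxx lerDl.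
  by apply: sumr_ge0 => j _; case: eqP.
have : \sum_(k < size s1) (row s1 k - row s2 k) = 0.
  rewrite sumrB; apply/eqP; rewrite subr_eq0; apply/eqP.
  by have := H c; rewrite /node_sum -sz.
move/eqP; rewrite psumr_eq0 => [/allP/(_ (Ordinal ilt))|k _].
  rewrite mem_index_enum => /(_ isT) /=; rewrite row2 // subr0 => /eqP e.
  by rewrite e in row1.
rewrite subr_ge0; have [ki|ik] := ltnP k i; last by rewrite row2.
by rewrite /row /row_len IH.
Qed.

End Nodes.

(** * Schur elements and their defects *)

Section Weight.
Variables (F : fieldType) (q : F).
Implicit Types A B W : seq F.

(** Twice Fayers' weight of a multiset A of residues, with W the multiset of
    the residues of the first nodes of the components. *)
Definition weight2 W A : int :=
  \sum_(x <- A) \sum_(w <- W) (x == w)%:R *+ 2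
  - \sum_(x <- A) \sum_(y <- A)
      ((x == y)%:R *+ 2 - (q * x == y)%:R - (x == q * y)%:R).

Lemma weight2_perm W W' A A' : perm_eq W W' -> perm_eq A A' ->
  weight2 W A = weight2 W' A'.
Proof.
move=> eW eA; rewrite /weight2 !(perm_big A' eA) /=; congr (_ - _).
  by apply: eq_bigr => x _; rewrite (perm_big W' eW).
by apply: eq_bigr => x _; rewrite (perm_big A' eA).
Qed.

Lemma weight2_scale W A c : c != 0 ->
  weight2 [seq c * x | x <- W] [seq c * x | x <- A] = weight2 W A.
Proof.
move=> c0; have cI := inj_eq (mulfI c0).
rewrite /weight2 !big_map; congr (_ - _); apply: eq_bigr => x _; rewrite big_map.
  by apply: eq_bigr => w _; rewrite cI.
by apply: eq_bigr => y _; rewrite ![q * (c * _)]mulrCA !cI.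
Qed.

End Weight.

Section CountHooks.
Variables (F : fieldType) (l n : nat) (Q : nat -> F) (q : F) (lam : mpart l n).
Hypothesis q_neq0 : q != 0.
Local Notation hk a b := (hook (component lam a) (component lam b)).

Definition node_residue (x : 'I_l * 'I_n * 'I_n) : F :=
  q ^ (x.2%:Z - x.1.2%:Z) * Q x.1.1.
Definition node_residues : seq F := [seq node_residue x | x <- enum (nodes lam)].

Lemma residue_shift (k : int) (u v : F) : (q ^ (- k) * u == v) = (u == q ^ k * v).
Proof.
have qk : q ^ k != 0 by rewrite expfz_neq0.
by rewrite -(inj_eq (mulfI qk)) mulrA -expfzDr // subrr expr0z mul1r.
Qed.

Lemma node_sum_sum (I : finType) (s : seq nat) (g : I -> nat -> nat -> int) :
  node_sum s (fun i j => \sum_b g b i j) = \sum_b node_sum s (g b).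
Proof.
by rewrite /node_sum exchange_big; apply: eq_bigr => i _; rewrite exchange_big.
Qed.

(** Each unordered pair of components contributes the hook lengths of both
    orders, hence the factor 2. *)
Lemma count_hooks :
  (\sum_a \sum_b node_sum (component lam a)
     (fun i j => (q ^ hk a b i j * Q a == Q b)%:R)) *+ 2 =
  weight2 q [seq Q a | a : 'I_l <- enum 'I_l] node_residues.
Proof.
pose f (a b : 'I_l) (k : int) : int := (q ^ k * Q a == Q b)%:R.
have fN a b k : f a b (- k) = f b a k by rewrite /f residue_shift eq_sym.
rewrite mulr2n {2}exchange_big -big_split /=.
transitivity (\sum_a \sum_b (
   node_sum (component lam a) (fun i j => f a b (j%:Z - i%:Z))
 + node_sum (component lam b) (fun i j => f a b (i%:Z - j%:Z))
 - node_sum (component lam a) (fun i j => node_sum (component lam b) (fun i' j' =>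
     second_diff (f a b) ((j%:Z - i%:Z) - (j'%:Z - i'%:Z)))))).
  apply: eq_bigr => a _; rewrite -big_split; apply: eq_bigr => b _ /=.
  rewrite -hooks_from_contents ?sorted_component //; congr (_ + _).
  by apply: eq_node_sum => i j _ _; rewrite fN.
under eq_bigr do rewrite sumrB big_split /=.
rewrite sumrB big_split /= [X in _ + X - _]exchange_big /weight2 !big_map /=.
have sum_res g : \sum_(x <- enum (nodes lam)) g (node_residue x) =
    \sum_a node_sum (component lam a) (fun i j => g (q ^ (j%:Z - i%:Z) * Q a)).
  by rewrite big_enum -(sum_nodes_int lam (fun a i j => g (q ^ (j%:Z - i%:Z) * Q a))).
congr (_ - _).
  rewrite (sum_res (fun x => \sum_(w <- [seq Q a | a : 'I_l <- enum 'I_l]) (x == w)%:R *+ 2)).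
  rewrite -big_split; apply: eq_bigr => a _ /=; rewrite -!node_sum_sum -node_sumD.
  apply: eq_node_sum => i j _ _; rewrite big_map big_enum -big_split; apply: eq_bigr => b _ /=.
  rewrite mulr2n; congr (_ + _).
  by rewrite -[i%:Z - _]opprB fN.
rewrite (sum_res (fun x => \sum_(y <- node_residues) ((x == y)%:R *+ 2
   - (q * x == y)%:R - (x == q * y)%:R))).
apply: eq_bigr => a _; rewrite -node_sum_sum; apply: eq_node_sum => i j _ _.
set x := q ^ _ * _; rewrite big_map.
rewrite (sum_res (fun y => (x == y)%:R *+ 2 - (q * x == y)%:R - (x == q * y)%:R)).
apply: eq_bigr => b _; apply: eq_node_sum => i' j' _ _; rewrite /second_diff /f.
set c := j%:Z - i%:Z in x *; set c' := j'%:Z - i'%:Z.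
have e k : (q ^ (c - c' + k) * Q a == Q b) = (q ^ k * x == q ^ c' * Q b).
  rewrite -(residue_shift c') /x mulrA mulrA -!expfzDr //.
  by congr (q ^ _ * _ == _); ring.
have e1 : (x == q * (q ^ c' * Q b)) = (q ^ (- 1) * x == q ^ c' * Q b).
  by rewrite residue_shift expr1z.
by rewrite e1 -{1}[c - c']addr0 !e expr0z mul1r expr1z.
Qed.

End CountHooks.

Section SchurValuation.
Variables (F : fieldType) (l n : nat) (Q : nat -> F) (q : F) (lam : mpart l n).
Hypothesis q_neq0 : q != 0.
Hypothesis qint_neq0 : forall k, (0 < k)%N -> qint q k != 0.
Hypothesis factor_neq0 : forall h (a b : 'I_l), b != a ->
  q ^ h * Q a * (Q b)^-1 - 1 != 0.
Local Notation hk a b := (hook (component lam a) (component lam b)).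

Lemma diagonal_hook_gt0 (a : 'I_l) (i : 'I_n) j :
  (j < row_len (component lam a) i)%N -> 0 < hk a a i j.
Proof. by move=> jl; rewrite hook_gt0 ?sorted_component ?size_component. Qed.

Lemma diagonal_hook_qint_neq0 (a : 'I_l) (i : 'I_n) j :
  (j < row_len (component lam a) i)%N -> qint q `|hk a a i j|%N != 0.
Proof. by move/diagonal_hook_gt0 => h; rewrite qint_neq0 // absz_gt0 gt_eqF. Qed.

Lemma node_factor_neq0 (a : 'I_l) (i : 'I_n) j :
  (j < row_len (component lam a) i)%N ->
  qint q `|hk a a i j|%N *
    \prod_(b < l | b != a) (q ^ hk a b i j * Q a * (Q b)^-1 - 1) != 0.
Proof.
move=> jl; rewrite mulf_neq0 ?diagonal_hook_qint_neq0 //.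
by apply/prodf_neq0 => b ba; apply: factor_neq0.
Qed.

Lemma schur_prefactor_neq0 : (-1) ^+ (n * l.-1) * q ^- part_N (mpart_bar lam) != 0.
Proof. by rewrite mulf_neq0 ?signr_eq0 // invr_eq0 expf_neq0. Qed.

Lemma schur_neq0 : ak_schur Q q lam != 0.
Proof.
rewrite /ak_schur mulf_neq0 ?schur_prefactor_neq0 //.
apply/prodf_neq0 => a _; apply/prodf_neq0 => i _; apply/prodf_neq0 => j _.
exact: node_factor_neq0.
Qed.

Variable v : F -> int.
Hypotheses (v1 : v 1 = 0) (vM : forall x y, x != 0 -> y != 0 -> v (x * y) = v x + v y).
Hypotheses (vN1 : v (-1) = 0) (vq : v q = 0).

Lemma val_schur : v (ak_schur Q q lam) =
  \sum_a node_sum (component lam a) (fun i j => v (qint q `|hk a a i j|%N)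
    + \sum_(b < l | b != a) v (q ^ hk a b i j * Q a * (Q b)^-1 - 1)).
Proof.
rewrite /ak_schur vM ?schur_prefactor_neq0 //; last first.
  apply/prodf_neq0 => a _; apply/prodf_neq0 => i _; apply/prodf_neq0 => j _.
  exact: node_factor_neq0.
have -> : v ((-1) ^+ (n * l.-1) * q ^- part_N (mpart_bar lam)) = 0.
  rewrite vM ?signr_eq0 ?invr_eq0 ?expf_neq0 // (val_inv v1 vM) ?expf_neq0 //.
  by rewrite !(val_exp v1 vM) ?oppr_eq0 ?oner_eq0 // vN1 vq !mul0rn subr0.
rewrite add0r (val_prod v1 vM) => [|a _]; last first.
  by apply/prodf_neq0 => i _; apply/prodf_neq0 => j _; exact: node_factor_neq0.
apply: eq_bigr => a _; rewrite (val_prod v1 vM) => [|i _]; last first.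
  by apply/prodf_neq0 => j _; exact: node_factor_neq0.
rewrite /node_sum size_component; apply: eq_bigr => i _.
rewrite (val_prod v1 vM) => [|j _]; last exact: node_factor_neq0.
apply: eq_bigr => j _; rewrite vM ?diagonal_hook_qint_neq0 //; last first.
  by apply/prodf_neq0 => b ba; apply: factor_neq0.
by congr (_ + _); rewrite (val_prod v1 vM) // => b ba; apply: factor_neq0.
Qed.

End SchurValuation.

Lemma posz_neq0 k : (0 < k)%N -> k%:Z != 0.
Proof. by case: k. Qed.

Section Monomials.
Variable l : nat.
Local Notation K := (cyclo l).
Implicit Types a b : K.

Lemma kcstM a b : kcst (a * b) = kcst a * kcst b.
Proof. by rewrite /kcst polyCM tofracM. Qed.

Lemma kcst1 : kcst (1 : K) = 1.
Proof. by rewrite /kcst polyC1 tofrac1. Qed.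

Lemma kcst_eq0 a : (kcst a == 0) = (a == 0).
Proof. by rewrite /kcst tofrac_eq0 polyC_eq0. Qed.

Lemma kcstV a : a != 0 -> kcst a^-1 = (kcst a)^-1.
Proof.
move=> a0; apply: (mulIf (_ : kcst a != 0)); first by rewrite kcst_eq0.
by rewrite -kcstM mulVf // mulVf ?kcst_eq0 // kcst1.
Qed.

Lemma monomial_natE a k : kcst a * yvar l ^+ k = (a *: 'X^k)%:F.
Proof. by rewrite -mul_polyC tofracM tofracXn. Qed.

Lemma monomial_inj a b (e f : int) : a != 0 ->
  kcst a * yvar l ^ e = kcst b * yvar l ^ f -> a = b /\ e = f.
Proof.
move=> a0 eq_ab; have y0 := yvar_neq0 l.
have [N [e' [f' [eE fE]]]] : exists N e' f' : nat, e = e'%:Z - N%:Z /\ f = f'%:Z - N%:Z.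
  pose N := (absz e + absz f)%N; exists N, (absz (e + N%:Z)), (absz (f + N%:Z)).
  rewrite /N; lia.
have : a *: 'X^e' = b *: 'X^f'.
  apply/eqP; rewrite -tofrac_eq -!monomial_natE; apply/eqP.
  move/(congr1 (fun z => z * yvar l ^ N%:Z)): eq_ab.
  by rewrite -!mulrA -!expfzDr // eE fE !subrK.
move/(congr1 (fun g : {poly K} => g`_e')); rewrite !coefZ !coefXn eqxx mulr1.
case: eqP => [ef|_]; last by rewrite mulr0 => /eqP; rewrite (negbTE a0).
by rewrite mulr1 => ->; split=> //; rewrite eE fE ef.
Qed.

End Monomials.

Section Schur.
Variables (l p n : nat) (rs : (l %/ p).-tuple int) (r : int).
Hypotheses (l_gt0 : (0 < l)%N) (p_gt0 : (0 < p)%N).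
Variables (eta : algC) (eta_neq0 : eta != 0).
Variables (Phi : {poly cyclo l}) (hPhi : is_minpoly eta Phi).
Local Notation q := (cycq l p r).
Local Notation Q := (cycQ rs).
Local Notation nuP := (nu Phi).

Definition qval : algC := eta ^ (p%:Z * r).
Definition Qval (a : nat) : algC := zeta l ^+ a * eta ^ rexp rs a.

Lemma zetaK_primitive : l.-primitive_root (zetaK l).
Proof.
by rewrite -(fmorph_primitive_root (val : {rmorphism cyclo l -> algC})) zeta_primitive.
Qed.

Lemma zetaK_neq0 : zetaK l != 0.
Proof.
apply/eqP => z0; have := prim_expr_order zetaK_primitive.
by rewrite z0 expr0n eqn0Ngt l_gt0 => /eqP; rewrite eq_sym oner_eq0.
Qed.

Lemma zeta_neq0 : zeta l != 0.
Proof. by rewrite (Qadj_val_eq0 (zetaK l)) zetaK_neq0. Qed.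

Lemma q_neq0 : q != 0.
Proof. by rewrite expfz_neq0 // yvar_neq0. Qed.

Lemma schur_factorE h a b : q ^ h * Q a * (Q b)^-1 =
  kcst (zetaK l ^+ a / zetaK l ^+ b) * yvar l ^ (p%:Z * r * h + rexp rs a - rexp rs b).
Proof.
have z0 k : zetaK l ^+ k != 0 by rewrite expf_neq0 // zetaK_neq0.
rewrite /cycq /cycQ invfM kcstM kcstV // exprz_exp !expfzDr ?yvar_neq0 //.
by rewrite -invr_expz; ring.
Qed.

Lemma schur_factor_neq1 h (a b : 'I_l) : b != a -> q ^ h * Q a * (Q b)^-1 != 1.
Proof.
move=> ba; have z0 k : zetaK l ^+ k != 0 by rewrite expf_neq0 // zetaK_neq0.
rewrite schur_factorE; apply: contra ba => /eqP.
rewrite -[RHS]mulr1 -[X in _ = X * _]kcst1 -[X in _ = _ * X](expr0z (yvar l)).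
case/monomial_inj => [|e _]; first by rewrite mulf_neq0 ?invr_eq0.
have /eqP : zetaK l ^+ a = zetaK l ^+ b by rewrite -[RHS]mul1r -e divfK.
by rewrite (eq_prim_root_expr zetaK_primitive) !modn_small // eq_sym => /eqP/val_inj ->.
Qed.


Lemma nu_schur_factor h (a b : 'I_l) : b != a ->
  nuP (q ^ h * Q a * (Q b)^-1 - 1) = (qval ^ h * Qval a == Qval b)%:R.
Proof.
move=> ba; have := schur_factor_neq1 h ba; rewrite schur_factorE => h1.
have z0 k : zetaK l ^+ k != 0 by rewrite expf_neq0 // zetaK_neq0.
rewrite (nu_monomial_sub1 hPhi eta_neq0) // ?mulf_neq0 ?invr_eq0 //.
congr (_%:R); congr nat_of_bool.
have zc0 : zeta l ^+ b * eta ^ rexp rs b != 0.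
  by rewrite mulf_neq0 ?expfz_neq0 // expf_neq0 // zeta_neq0.
rewrite -[in RHS](inj_eq (mulIf (invr_neq0 zc0))) divff //.
congr (_ == _); rewrite rmorphM fmorphV !rmorphXn /= /qval /Qval exprz_exp.
by rewrite !expfzDr // -invr_expz invfM; ring.
Qed.

Lemma yvar_expz_neq1 e : e != 0 -> yvar l ^ e != 1.
Proof.
apply: contra => /eqP; rewrite -[LHS]mul1r -[RHS]mulr1 -kcst1.
rewrite -[X in _ = _ * X](expr0z (yvar l)).
by case/monomial_inj; rewrite ?oner_eq0 // => _ ->.
Qed.

Lemma nu_yvar_sub1 e : e != 0 -> nuP (yvar l ^ e - 1) = (eta ^ e == 1)%:R.
Proof.
move=> e0; have := @nu_monomial_sub1 _ _ _ hPhi eta_neq0 1 e.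
by rewrite oner_eq0 kcst1 mul1r rmorph1 mul1r; apply=> //; exact: yvar_expz_neq1.
Qed.

Lemma kcst_nat k : kcst (k%:R : cyclo l) = k%:R.
Proof. by rewrite /kcst polyC_natr rmorph_nat. Qed.

Lemma Ky_nat_eq0 k : (k%:R == 0 :> cycloy l) = (k == 0%N).
Proof.
rewrite -kcst_nat kcst_eq0 -Qadj_val_eq0 rmorph_nat; exact: pnatr_eq0.
Qed.

Lemma nu_nat k : (0 < k)%N -> nuP (k%:R) = 0.
Proof.
move=> k0; rewrite -kcst_nat; apply: nu_kcst hPhi _ _.
by rewrite -kcst_eq0 kcst_nat Ky_nat_eq0 -lt0n.
Qed.

Lemma qint_neq0 k : (0 < k)%N -> qint q k != 0.
Proof.
move=> k0; have [r0|r0] := eqVneq r 0.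
  rewrite /qint /cycq r0 mulr0 expr0z (eq_bigr (fun=> 1)) => [|i _]; last by rewrite expr1n.
  by rewrite sumr_const card_ord Ky_nat_eq0 -lt0n.
apply/eqP => e; have := subrX1 q k; rewrite -/(qint q k) e mulr0 => /eqP.
rewrite subr_eq0 /cycq exprnP exprz_exp (negbTE (yvar_expz_neq1 _)) //.
by rewrite !mulf_neq0 // posz_neq0.
Qed.

Lemma nu_qint k : (0 < k)%N ->
  nuP (qint q k) = (qval ^+ k == 1)%:R - (qval == 1)%:R.
Proof.
move=> k0; rewrite /qval; have [r0|r0] := eqVneq r 0.
  rewrite /qint /cycq r0 mulr0 !expr0z expr1n eqxx subrr.
  rewrite (eq_bigr (fun=> 1)) => [|i _]; last by rewrite expr1n.
  by rewrite sumr_const card_ord nu_nat.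
have pr0 : p%:Z * r != 0 by rewrite !mulf_neq0 // posz_neq0.
have prk0 : p%:Z * r * k%:Z != 0 by rewrite !mulf_neq0 // posz_neq0.
have q1 : q - 1 != 0 by rewrite subr_eq0 yvar_expz_neq1.
have := congr1 nuP (subrX1 q k); rewrite -/(qint q k) (nuM hPhi q1 (qint_neq0 k0)).
rewrite {1 2}/cycq exprnP exprz_exp !nu_yvar_sub1 // exprnP exprz_exp => ->.
by rewrite addrAC subrr add0r.
Qed.


Local Notation schur := (@ak_schur l n (cycloy l) Q q).

Lemma schur_factor_sub1_neq0 h (a b : 'I_l) : b != a ->
  q ^ h * Q a * (Q b)^-1 - 1 != 0.
Proof. by move=> ba; rewrite subr_eq0; exact: schur_factor_neq1. Qed.

Lemma ak_schur_neq0 (lam : mpart l n) : schur lam != 0.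
Proof. exact: schur_neq0 q_neq0 qint_neq0 schur_factor_sub1_neq0. Qed.

Lemma nuN1 : nuP (-1) = 0.
Proof.
have -> : -1 = kcst (-1) :> cycloy l by rewrite /kcst polyCN tofracN polyC1 tofrac1.
by apply: nu_kcst hPhi _ _; rewrite oppr_eq0 oner_eq0.
Qed.

Lemma Qval_neq0 a : Qval a != 0.
Proof.
by rewrite mulf_neq0 ?expfz_neq0 // expf_neq0 // zeta_neq0.
Qed.

(** The q-integers [h]_q are the factors with b = a divided by q - 1, or units
    when q = 1; either way they account for the last term. *)
Lemma nu_ak_schur_hooks (lam : mpart l n) : nuP (schur lam) =
  \sum_(a < l) \sum_(b < l) node_sum (component lam a)
     (fun i j => (qval ^ hook (component lam a) (component lam b) i j * Qval a == Qval b)%:R)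
  - (qval == 1)%:R *+ n.
Proof.
have -> := val_schur lam q_neq0 qint_neq0 schur_factor_sub1_neq0 (nu1 hPhi) (nuM hPhi)
   nuN1 (nu_yvarX hPhi eta_neq0 _).
transitivity (\sum_(a < l) (\sum_(b < l) node_sum (component lam a)
     (fun i j => (qval ^ hook (component lam a) (component lam b) i j * Qval a == Qval b)%:R)
     - node_sum (component lam a) (fun _ _ => (qval == 1)%:R))); last first.
  rewrite sumrB; congr (_ - _).
  by rewrite -(sum_nodes_int lam (fun _ _ _ => (qval == 1)%:R)) sumr_const card_nodes.
apply: eq_bigr => a _; rewrite /node_sum size_component exchange_big -sumrB.
apply: eq_bigr => i _; rewrite exchange_big -sumrB; apply: eq_bigr => j _ /=.
have h0 := diagonal_hook_gt0 (ltn_ord j).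
rewrite nu_qint; last by rewrite absz_gt0 gt_eqF.
rewrite [in RHS](bigD1 a) //= addrAC; congr (_ + _ - _).
  by rewrite -{2}[Qval a]mul1r (inj_eq (mulIf (Qval_neq0 a))) -[in RHS](gtz0_abs h0).
by apply: eq_bigr => b ba; rewrite nu_schur_factor.
Qed.

Lemma qval_neq0 : qval != 0.
Proof. by rewrite expfz_neq0. Qed.

Theorem nu_ak_schur (lam : mpart l n) : nuP (schur lam) *+ 2 =
  weight2 qval [seq Qval a | a : 'I_l <- enum 'I_l] (node_residues Qval qval lam)
  - (qval == 1)%:R *+ n *+ 2.
Proof.
by rewrite nu_ak_schur_hooks mulrnBl count_hooks // qval_neq0.
Qed.

End Schur.

(** * Rotation of the components of a multipartition *)

Section SchurRotation.
Variables (F : fieldType) (l n : nat) (Q : nat -> F) (q : F).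
Variables (lam mu : mpart l n) (sigma : 'I_l -> 'I_l).
Hypothesis sigma_inj : injective sigma.
Hypothesis Qsigma : forall a b : 'I_l, Q (sigma a) * (Q (sigma b))^-1 = Q a * (Q b)^-1.

Lemma mpart_bar_rotation :
  (forall b, component lam (sigma b) = component mu b) ->
  mpart_bar lam = mpart_bar mu.
Proof.
move=> e; rewrite /mpart_bar.
have geq_total : total geq by move=> x y; exact: leq_total.
have geq_trans : transitive geq by move=> a b c /= ba ac; exact: leq_trans ac ba.
have geq_anti : antisymmetric geq by move=> x y; rewrite /= andbC; exact: anti_leq.
apply/(perm_sortP geq_total geq_trans geq_anti)/perm_flatten.
have -> : [seq component mu a | a <- enum 'I_l] =
    [seq component lam a | a <- [seq sigma a | a <- enum 'I_l]].
  by rewrite -map_comp; apply: eq_map => b /=; rewrite e.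
apply/perm_map; apply: uniq_perm; [exact: enum_uniq | | move=> a].
  by rewrite (map_inj_uniq sigma_inj); exact: enum_uniq.
rewrite mem_enum inE; apply/esym/mapP; exists (invF sigma_inj a).
  by rewrite mem_enum.
by rewrite f_invF.
Qed.

Lemma ak_schur_rotation :
  (forall b, component lam (sigma b) = component mu b) ->
  ak_schur Q q lam = ak_schur Q q mu.
Proof.
move=> e; rewrite /ak_schur mpart_bar_rotation //; congr (_ * _).
rewrite (reindex_inj sigma_inj) /=; apply: eq_bigr => a _.
rewrite e; apply: eq_bigr => i _; apply: eq_bigr => j _; congr (_ * _).
rewrite (reindex_inj sigma_inj) /=; apply: eq_big => [b|b ba].
  by rewrite (inj_eq sigma_inj).
by rewrite e -!mulrA Qsigma.
Qed.

Definition hook_prod (nu : mpart l n) : nat :=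
  \prod_(a < l) \prod_(i < n) \prod_(j < row_len (component nu a) i)
    `|hook (component nu a) (component nu a) i j|%N.

Lemma hook_prod_gt0 nu : (0 < hook_prod nu)%N.
Proof.
apply: prodn_gt0 => a; apply: prodn_gt0 => i; apply: prodn_gt0 => j.
by rewrite absz_gt0 gt_eqF // diagonal_hook_gt0.
Qed.

(** For q = 1 the factors with b <> a do not depend on the hook lengths. *)
Lemma ak_schur_q1 nu : q = 1 -> ak_schur Q q nu =
  (hook_prod nu)%:R * ((-1) ^+ (n * l.-1) *
    \prod_(a < l) (\prod_(b < l | b != a) (Q a * (Q b)^-1 - 1)) ^+ sumn (component nu a)).
Proof.
move=> q1; rewrite /ak_schur q1 expr1n invr1 mulr1 mulrCA; congr (_ * _).
rewrite /hook_prod natr_prod -big_split; apply: eq_bigr => a _ /=.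
rewrite natr_prod sumn_row_len size_component -prodrXr -big_split; apply: eq_bigr => i _ /=.
rewrite natr_prod -[X in _ ^+ X]card_ord -prodr_const -big_split; apply: eq_bigr => j _ /=.
congr (_ * _).
  by rewrite /qint (eq_bigr (fun=> 1)) ?sumr_const ?card_ord // => k _; rewrite expr1n.
by apply: eq_bigr => b _; rewrite exp1rz mul1r.
Qed.

Lemma ak_schur_q1_rotation : q = 1 ->
  (forall b, sumn (component lam (sigma b)) = sumn (component mu b)) ->
  (hook_prod mu)%:R * ak_schur Q q lam = (hook_prod lam)%:R * ak_schur Q q mu.
Proof.
move=> q1 e; rewrite !ak_schur_q1 // mulrCA; congr (_ * (_ * (_ * _))).
rewrite (reindex_inj sigma_inj) /=; apply: eq_bigr => a _; rewrite e; congr (_ ^+ _).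
rewrite (reindex_inj sigma_inj) /=; apply: eq_big => [b|b ba].
  by rewrite (inj_eq sigma_inj).
by rewrite Qsigma.
Qed.

End SchurRotation.

Lemma double_int_inj (x y : int) : x *+ 2 = y *+ 2 -> x = y.
Proof. lia. Qed.

Lemma ratio_eq1 (F : fieldType) (q x y : F) (e f : int) : q != 0 -> y != 0 ->
  q ^ e * x = q ^ f * y -> q ^ (e - f) * x * y^-1 = 1.
Proof.
move=> q0 y0 e1; have qf0 : q ^ f != 0 by rewrite expfz_neq0.
by rewrite expfzDr // -invr_expz -mulrA mulf_div e1 divff // mulf_neq0.
Qed.

Section Rotation.
Variables (l p n : nat) (rs : (l %/ p).-tuple int) (r : int).
Hypotheses (l_gt0 : (0 < l)%N) (p_gt0 : (0 < p)%N) (p_dvd_l : (p %| l)%N).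
Local Notation d := (l %/ p)%N.

Definition rotate (j : nat) (a : 'I_l) : 'I_l :=
  Ordinal (ltn_pmod (a + d * j) l_gt0).

Lemma rotate_inj j : injective (rotate j).
Proof.
move=> a b /(congr1 val) /= /eqP; rewrite eqn_modDr !modn_small // => /eqP.
exact: val_inj.
Qed.

Lemma rexp_rotate j a : rexp rs (rotate j a) = rexp rs a.
Proof.
have dl : (d %| l)%N by apply: dvdn_div.
by rewrite /rexp /= modn_dvdm // addnC mulnC modnMDl.
Qed.

Lemma cycQ_rotate j a :
  cycQ rs (rotate j a) = kcst ((zetaK l ^+ d) ^+ j) * cycQ rs a.
Proof.
rewrite /cycQ rexp_rotate mulrA -kcstM /= (prim_expr_mod (zetaK_primitive l_gt0)).
by rewrite exprD exprM [_ ^+ a * _]mulrC.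
Qed.

Lemma Qval_rotate eta j a :
  Qval rs eta (rotate j a) = (zeta l ^+ d) ^+ j * Qval rs eta a.
Proof.
rewrite /Qval rexp_rotate /= (prim_expr_mod (zeta_primitive l_gt0)) mulrA.
by rewrite exprD exprM [_ ^+ a * _]mulrC.
Qed.

Local Notation q := (cycq l p r).
Local Notation Q := (cycQ rs).
Local Notation schur := (@ak_schur l n (cycloy l) Q q).

Section SameDefect.
Variables (eta : algC) (eta_neq0 : eta != 0).
Variables (Phi : {poly cyclo l}) (hPhi : is_minpoly eta Phi).
Local Notation residues := (node_residues (Qval rs eta) (qval p r eta)).

Lemma nu_ak_schur_rotation (lam mu : mpart l n) j :
  perm_eq (residues lam) [seq (zeta l ^+ d) ^+ j * y | y <- residues mu] ->
  nu Phi (schur lam) = nu Phi (schur mu).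
Proof.
move=> e; have z0 : (zeta l ^+ d) ^+ j != 0.
  exact: expf_neq0 _ (expf_neq0 _ (zeta_neq0 l_gt0)).
apply: double_int_inj.
rewrite !(nu_ak_schur rs r l_gt0 p_gt0 eta_neq0 hPhi); congr (_ - _).
rewrite -[RHS](weight2_scale _ _ _ z0); apply: weight2_perm => //.
have -> : [seq (zeta l ^+ d) ^+ j * x | x <- [seq Qval rs eta a | a : 'I_l <- enum 'I_l]]
  = [seq Qval rs eta a | a : 'I_l <- [seq rotate j b | b <- enum 'I_l]].
  by rewrite -!map_comp; apply: eq_map => a /=; rewrite Qval_rotate.
apply/perm_map/uniq_perm; [exact: enum_uniq | | move=> a].
  by rewrite (map_inj_uniq (@rotate_inj j)); exact: enum_uniq.
rewrite mem_enum inE; apply/esym/mapP; exists (invF (@rotate_inj j) a).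
  by rewrite mem_enum.
by rewrite f_invF.
Qed.

End SameDefect.

Section Generic.
Variables (lam mu : mpart l n) (j0 : nat).
Local Notation residues := (node_residues Q q).
Hypothesis same_residues :
  perm_eq (residues lam) [seq kcst ((zetaK l ^+ d) ^+ j0) * y | y <- residues mu].

Lemma cycQ_eq (a b : 'I_l) (e f : int) : (q ^ e * Q a == q ^ f * Q b) =
  (a == b) && (q ^ e == q ^ f).
Proof.
have z0 k : zetaK l ^+ k != 0 by rewrite expf_neq0 // zetaK_neq0.
have Q0 : Q b != 0 by rewrite mulf_neq0 ?kcst_eq0 ?z0 // expfz_neq0 // yvar_neq0.
have [->|ab] := eqVneq a b; first by rewrite /= (inj_eq (mulIf Q0)).
have ba : b != a by rewrite eq_sym.
apply: contraNF (schur_factor_neq1 rs r l_gt0 (e - f) ba) => /eqP e1.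
by apply/eqP; exact: ratio_eq1 (q_neq0 l p r) Q0 e1.
Qed.

Lemma same_residue_counts b (c : int) :
  node_sum (component lam (rotate j0 b)) (fun i j => (q ^ (j%:Z - i%:Z) == q ^ c)%:R)
  = node_sum (component mu b) (fun i j => (q ^ (j%:Z - i%:Z) == q ^ c)%:R).
Proof.
have count_res (nu : mpart l n) k b' :
  \sum_(x <- residues nu) (kcst ((zetaK l ^+ d) ^+ k) * x
       == q ^ c * Q (rotate k b'))%:R
  = node_sum (component nu b') (fun i j => (q ^ (j%:Z - i%:Z) == q ^ c)%:R).
  have e0 : kcst ((zetaK l ^+ d) ^+ k) != 0.
    by rewrite kcst_eq0; exact: expf_neq0 _ (expf_neq0 _ (zetaK_neq0 l_gt0)).
  rewrite big_map big_enum /node_residue.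
  rewrite (sum_nodes_int nu (fun a i j => (kcst ((zetaK l ^+ d) ^+ k) *
     (q ^ (j%:Z - i%:Z) * Q a) == q ^ c * Q (rotate k b'))%:R)).
  have e1 a i j : (kcst ((zetaK l ^+ d) ^+ k) * (q ^ (j%:Z - i%:Z) * Q (a : 'I_l))
      == q ^ c * Q (rotate k b')) = (a == b') && (q ^ (j%:Z - i%:Z) == q ^ c).
    by rewrite cycQ_rotate [q ^ c * _]mulrCA (inj_eq (mulfI e0)) cycQ_eq.
  rewrite (bigD1 b') //= [X in _ + X]big1 ?addr0 => [|a ab]; last first.
    by rewrite /node_sum big1 // => i _; rewrite big1 // => j _; rewrite e1 (negbTE ab).
  by apply: eq_node_sum => i j _ _; rewrite e1 eqxx.
rewrite -(count_res mu j0).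
rewrite -(big_map (fun y => kcst ((zetaK l ^+ d) ^+ j0) * y) xpredT
   (fun x => (x == q ^ c * Q (rotate j0 b))%:R)) -(perm_big _ same_residues) /=.
rewrite -(count_res lam 0); apply: eq_bigr => x _.
have -> : rotate 0 (rotate j0 b) = rotate j0 b.
  by apply: val_inj; rewrite /= muln0 addn0 modn_mod.
by rewrite expr0 kcst1 mul1r.
Qed.

(** Equal contents over K(y) mean equal components up to rotation, unless q = 1,
    when the contents only show the sizes of the components. *)
Theorem ak_schur_same_residues : exists h1 h2 : nat,
  [/\ (0 < h1)%N, (0 < h2)%N & h1%:R * schur lam = h2%:R * schur mu].
Proof.
have Qs (a b : 'I_l) : Q (rotate j0 a) * (Q (rotate j0 b))^-1 = Q a * (Q b)^-1.
  have e0 : kcst ((zetaK l ^+ d) ^+ j0) != 0.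
    by rewrite kcst_eq0; exact: expf_neq0 _ (expf_neq0 _ (zetaK_neq0 l_gt0)).
  by rewrite !cycQ_rotate invfM mulrACA divff // mul1r.
have [r0|r0] := eqVneq r 0.
  have q1 : q = 1 by rewrite /cycq r0 mulr0 expr0z.
  exists (hook_prod mu), (hook_prod lam); split; rewrite ?hook_prod_gt0 //.
  apply: (ak_schur_q1_rotation (@rotate_inj j0) Qs q1) => b.
  have sumnE (nu : mpart l n) a : node_sum (component nu a)
      (fun i j => (q ^ (j%:Z - i%:Z) == q ^ 0)%:R) = (sumn (component nu a))%:Z.
    rewrite sumn_row_len -[RHS]natz natr_sum; apply: eq_bigr => i _.
    rewrite (eq_bigr (fun=> 1)) => [|k _]; last by rewrite q1 !exp1rz eqxx.
    by rewrite sumr_const card_ord.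
  by have := same_residue_counts b 0; rewrite !sumnE => -[].
suff e b : component lam (rotate j0 b) = component mu b.
  exists 1%N, 1%N; split=> //.
  by have -> : schur lam = schur mu by exact: (ak_schur_rotation q (@rotate_inj j0) Qs e).
apply: contents_determine; rewrite ?size_component ?sorted_component // => c.
have qE (e f : int) : (q ^ e == q ^ f) = (e == f).
  apply/eqP/eqP => [|-> //]; rewrite /cycq !exprz_exp -[LHS]mul1r -[RHS]mul1r -kcst1.
  case/monomial_inj; first exact: oner_neq0.
  move=> _ /(mulfI _); apply; rewrite mulf_neq0 // posz_neq0 //.
have := same_residue_counts b c.
by rewrite !(eq_node_sum (fun i j _ _ => congr1 (fun t : bool => t%:R) (qE _ _))).
Qed.

End Generic.
End Rotation.

(** * Central characters and blocks *)

Section JucysMurphyAction.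
Variables (F : fieldType) (l n : nat) (Q : nat -> F) (q : F).
Variables (V : forall lam : mpart l n, hrep (@ak_cst F l n Q q) id #|std_tab lam|).
Hypothesis hV : standard_labelling V.
Local Notation L := (jucys_murphy l n Q q).

Lemma tab_eigenvalueE (lam : mpart l n) (t : std_tab lam) k :
  tab_eigenvalue Q q t k = node_residue Q q (val t k).
Proof. by rewrite /tab_eigenvalue /node_residue; case: (fun_of_fin _ k) => [[b i] j]. Qed.

Lemma jm_psum_action (lam : mpart l n) a :
  V lam (\sum_(k < n) L k ^+ a) = (psum (node_residues Q q lam) a)%:M.
Proof.
case: hV => _ _ _ /(_ lam) [P Punit PV].
have PX (k : 'I_n) : P *m V lam (L k ^+ a) =
    diag_mx (\row_s tab_eigenvalue Q q (enum_val s) k ^+ a) *m P.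
  elim: a => [|a IH].
    rewrite expr0 rmorph1 mulmx1 (_ : \row__ _ = const_mx 1) ?diag_const_mx ?mul1mx //.
    by apply/rowP => s; rewrite !mxE.
  rewrite exprSr rmorphM -mulmxE mulmxA IH -mulmxA PV mulmxA mulmx_diag.
  by congr (diag_mx _ *m P); apply/rowP => s; rewrite !mxE exprSr.
apply: (can_inj (mulKmx Punit)).
rewrite rmorph_sum mulmx_sumr (eq_bigr _ (fun k _ => PX k)) -mulmx_suml.
rewrite mul_mx_scalar -mul_scalar_mx; congr (_ *m P).
rewrite -diag_const_mx -raddf_sum; congr diag_mx; apply/rowP => s.
rewrite summxE !mxE /psum big_map big_enum -(sum_std_tab (enum_val s)).
by apply: eq_bigr => k _; rewrite !mxE tab_eigenvalueE.
Qed.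

Lemma jm_prod_psum_action (lam : mpart l n) s :
  V lam (\prod_(a <- s) \sum_(k < n) L k ^+ a)
  = (\prod_(a <- s) psum (node_residues Q q lam) a)%:M.
Proof.
elim: s => [|a s IH]; first by rewrite !big_nil rmorph1.
by rewrite !big_cons rmorphM IH jm_psum_action [RHS]scalar_mxM.
Qed.

End JucysMurphyAction.

Section Reduction.
Variables (l : nat) (eta : algC).
Variable theta : {rmorphism laurent l -> Qadj [:: zeta l; eta]}.
Variables (H : pzRingType) (c : laurent l -> H).

Lemma residue0 v : residue theta 0 v -> v = 0.
Proof.
case=> a [b [b0 /esym/eqP ab ->]].
move: ab; rewrite mulf_eq0 invr_eq0 => /orP[/eqP a0|/eqP vb0].
  have -> : a = 0 by apply: val_inj; rewrite a0 rmorph0.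
  by rewrite rmorph0 mul0r.
case/eqP: b0; have -> : b = 0 by apply: val_inj; rewrite vb0 rmorph0.
by rewrite rmorph0.
Qed.

(** An operator that is 0 on a lattice reduces to 0. *)
Lemma decomposition_number_ann m (V : hrep c (@laurent_val l) m) k
    (M : hrep c theta k) e : decomposition_number V M e -> e != 0%N ->
  forall h, V h = 0 -> M h = 0.
Proof.
case=> P [W [_ red [N [U [_ ->]]]]]; rewrite -lt0n card_gt0 => /set0Pn[i].
rewrite inE => /asboolP[B [Bfull _ BM]] h V0.
have W0 : W h = 0.
  apply/matrixP => i1 i2; rewrite mxE; apply: residue0.
  by have := red h i1 i2; rewrite V0 mulmx0 mul0mx mxE.
by apply: (row_full_inj Bfull); rewrite -BM W0 !mulmx0 mul0mx.
Qed.

End Reduction.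

Section Contents.
Variables (l p n : nat) (rs : (l %/ p).-tuple int) (r : int).
Local Notation q := (cycq l p r).
Local Notation Q := (cycQ rs).

(** The content of a node as a monomial over the ring of integers, which
    specialises both to K(y) and to K(eta). *)
Definition content (x : 'I_l * 'I_n * 'I_n) : laurent l :=
  lmonom l x.1.1 (p%:Z * r * (x.2%:Z - x.1.2%:Z) + rexp rs x.1.1).

Definition central_value (s : seq nat) (lam : mpart l n) : laurent l :=
  \prod_(a <- s) \sum_(x in nodes lam) content x ^+ a.

Lemma central_value_morph (F : fieldType) (f : {rmorphism laurent l -> F})
    (Qf : nat -> F) (qf : F) s lam :
  (forall x, f (content x) = node_residue Qf qf x) ->
  f (central_value s lam) = \prod_(a <- s) psum (node_residues Qf qf lam) a.
Proof.
move=> fE; rewrite rmorph_prod; apply: eq_bigr => a _.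
rewrite rmorph_sum /psum big_map big_enum; apply: eq_bigr => x _.
by rewrite rmorphXn fE.
Qed.

Lemma val_content x : val (content x) = node_residue Q q x.
Proof.
rewrite /content /node_residue val_lmonom /cycQ /cycq exprz_exp.
by rewrite (expfzDr _ _ (yvar_neq0 l)) mulrCA.
Qed.

Lemma val_central_value s lam :
  val (central_value s lam) = \prod_(a <- s) psum (node_residues Q q lam) a.
Proof.
exact: (central_value_morph (f := (val : {rmorphism laurent l -> cycloy l}))
  s lam val_content).
Qed.

Variables (eta : algC) (eta_neq0 : eta != 0).
Variable theta : {rmorphism laurent l -> Qadj [:: zeta l; eta]}.
Hypothesis htheta : specialisation theta.

Lemma theta_lmonom a e : val (theta (lmonom l a e)) = zeta l ^+ a * eta ^ e.
Proof.
case: htheta => theta_cst theta_y.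
have thM x y : val (theta (x * y)) = val (theta x) * val (theta y).
  by rewrite rmorphM [LHS]rmorphM.
have th0 b : val (theta (lmonom l b 0)) = zeta l ^+ b.
  rewrite (theta_cst _ (zetaK l ^+ b)) ?val_lmonom ?expr0z ?mulr1 //.
  by rewrite rmorphXn.
have lD b e1 e2 : lmonom l b (e1 + e2) = lmonom l b e1 * lmonom l 0 e2.
  apply: val_inj; transitivity (val (lmonom l b e1) * val (lmonom l 0 e2)); last first.
    exact/esym/rmorphM.
  rewrite !val_lmonom expr0 kcst1 mul1r.
  by rewrite (expfzDr _ _ (yvar_neq0 l)) mulrA.
have th1 : val (theta (lmonom l 0 1)) = eta.
  by apply: theta_y; rewrite val_lmonom0 expr1z.
have thn (k : nat) : val (theta (lmonom l 0 k)) = eta ^+ k.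
  elim: k => [|k IH]; first by rewrite th0.
  by rewrite -addn1 PoszD lD thM IH th1 exprD expr1.
have the : val (theta (lmonom l 0 e)) = eta ^ e.
  case: e => k; first by rewrite thn.
  have ek0 : eta ^+ k.+1 != 0 by rewrite expf_neq0.
  apply: (mulIf ek0); rewrite -thn -thM -lD NegzE addNr th0 thn.
  by rewrite -exprnN mulVf.
by rewrite -[e]add0r lD thM th0 the add0r.
Qed.

Lemma theta_content x :
  val (theta (content x)) = node_residue (Qval rs eta) (qval p r eta) x.
Proof.
rewrite /content /node_residue theta_lmonom /Qval /qval exprz_exp.
by rewrite expfzDr // mulrCA.
Qed.

Lemma theta_central_value s lam : val (theta (central_value s lam)) =
  \prod_(a <- s) psum (node_residues (Qval rs eta) (qval p r eta) lam) a.
Proof.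
rewrite rmorph_prod [LHS]rmorph_prod; apply: eq_bigr => a _.
rewrite rmorph_sum [LHS]rmorph_sum /psum big_map big_enum; apply: eq_bigr => x _.
by rewrite rmorphXn [LHS]rmorphXn /= theta_content.
Qed.

End Contents.

Section ConstantMultiples.
Variable l : nat.

Lemma kcstX (a : cyclo l) k : kcst (a ^+ k) = kcst a ^+ k.
Proof. by rewrite /kcst rmorphXn /= tofracXn. Qed.

Definition is_const (x : cycloy l) := exists a : cyclo l, x = kcst a.

Lemma is_constD x y : is_const x -> is_const y -> is_const (x + y).
Proof. by move=> [a ->] [b ->]; exists (a + b); rewrite /kcst polyCD tofracD. Qed.

Lemma is_constM x y : is_const x -> is_const y -> is_const (x * y).
Proof. by move=> [a ->] [b ->]; exists (a * b); rewrite kcstM. Qed.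

Lemma is_constV x : is_const x -> is_const x^-1.
Proof.
move=> [a ->]; have [->|a0] := eqVneq a 0; last by exists a^-1; rewrite kcstV.
by exists 0; rewrite /kcst polyC0 tofrac0 invr0.
Qed.

Lemma is_const_nat k : is_const k%:R.
Proof. by exists k%:R; rewrite kcst_nat. Qed.

Lemma is_const_sum (I : finType) (X : I -> cycloy l) :
  (forall i, is_const (X i)) -> is_const (\sum_i X i).
Proof.
move=> cX; apply: big_ind => [|x y|i _]; [exact: (is_const_nat 0) | exact: is_constD |].
exact: cX.
Qed.

End ConstantMultiples.

Lemma ratio_nat (F : fieldType) (h1 h2 : nat) (x y : F) :
  h1%:R != 0 :> F -> h2%:R != 0 :> F -> h1%:R * x = h2%:R * y ->
  x^-1 = h1%:R * h2%:R^-1 * y^-1.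
Proof.
move=> h10 h20 e; have -> : x = h2%:R * h1%:R^-1 * y.
  by rewrite mulrAC -e [_ * x]mulrC mulfK.
by rewrite !invfM invrK [h2%:R^-1 * _]mulrC.
Qed.

(** Elements acting by scalars of the base ring act by the same scalars on
    every module with a smaller annihilator, in any specialisation. *)
Lemma scalar_action (A : Type) (H : pzRingType) (c : A -> H)
    (F F' : fieldType) (f : A -> F) (f' : A -> F')
    m (V : hrep c f m) k (M : hrep c f' k) h a :
  (forall h, V h = 0 -> M h = 0) -> V h = (f a)%:M -> M h = (f' a)%:M.
Proof.
move=> ann Vh; apply/eqP; rewrite -subr_eq0 -(hrep_scalar M) -rmorphB; apply/eqP.
by apply: ann; rewrite rmorphB Vh hrep_scalar subrr.
Qed.

Lemma scalar_mx_inj_gt0 (R : pzRingType) m (a b : R) : (0 < m)%N ->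
  a%:M = b%:M :> 'M_m -> a = b.
Proof. by case: m => // m _ /matrixP/(_ ord0 ord0); rewrite !mxE eqxx. Qed.

Section Blocks.
Variables (l p n : nat).
Hypotheses (l_gt0 : (0 < l)%N) (p_gt0 : (0 < p)%N) (p_dvd_l : (p %| l)%N).
Hypothesis n_ge2 : (2 <= n)%N.
Variables (rs : (l %/ p).-tuple int) (r : int).
Variable iota : {rmorphism cyc_hecke n rs r -> cyc_ak n rs r}.
Hypothesis hiota : hecke_in_ak iota.
Variable V : forall lam : mpart l n, hrep (cyc_ak_cst n rs r) id #|std_tab lam|.
Hypothesis hV : standard_labelling V.
Variable Irr : irr_system (cyc_cst n rs r) (@laurent_val l).
Variable s : Irr -> cycloy l.
Hypothesis hs : schur_elements iota V s.
Local Notation q := (cycq l p r).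
Local Notation Q := (cycQ rs).
Local Notation schur := (@ak_schur l n (cycloy l) Q q).
Local Notation d := (l %/ p)%N.
Local Notation omega := (central_value rs r).

Lemma central_elements (w : seq nat) : (p %| sumn w)%N ->
  exists h, forall lam, V lam (iota h) = (val (omega w lam))%:M.
Proof.
move=> pw; case: (hiota) => _ _ [u [uT Tu iota1]] _.
have [h hE] := jm_psum_im p_gt0 n_ge2 hiota uT Tu iota1 pw.
exists h => lam; rewrite hE val_central_value; exact: jm_prod_psum_action.
Qed.

Lemma restriction (lam : mpart l n) :
  exists W : hrep (cyc_cst n rs r) (@laurent_val l) #|std_tab lam|,
    forall h, W h = V lam (iota h).
Proof.
have [|||W WE] := @hrep_exists _ _ (cyc_cst n rs r) _ (@laurent_val l)
    #|std_tab lam| (fun h => V lam (iota h)); last by exists W.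
- by move=> x y; rewrite !rmorphB.
- by split=> [|x y]; rewrite ?rmorph1 // !rmorphM.
move=> a; case: hiota => /(_ a) e _ _ _; rewrite e; exact: hrep_scalar.
Qed.

Lemma Ky_char0 : [pchar cycloy l] =i pred0.
Proof. by apply/pcharf0P => k; exact: Ky_nat_eq0. Qed.

(** Expand both expressions of the trace form in characters of simple modules:
    mult lam E is the multiplicity of E in the restriction of V lam. *)
Lemma schur_element_sum : exists mult : mpart l n -> Irr -> nat,
  (forall E, (s E)^-1 = \sum_lam (mult lam E)%:R * (schur lam)^-1) /\
  (forall lam E, mult lam E != 0%N ->
     forall h, V lam (iota h) = 0 -> irr_mod E h = 0).
Proof.
have dec lam : exists m : Irr -> nat,
    (forall h, \tr (V lam (iota h)) = \sum_E (m E)%:R * \tr (irr_mod E h)) /\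
    (forall E, m E != 0%N -> forall h, V lam (iota h) = 0 -> irr_mod E h = 0).
  have [W WE] := restriction lam.
  have [m [trm anm]] := character_decomposition Irr W.
  exists m; split=> [h|E mE h Vh]. rewrite -WE; exact: trm.
  by apply: (anm E mE h); rewrite WE.
have [mult multP] := choice dec; exists mult; split; last first.
  by move=> lam; exact: (proj2 (multP lam)).
move=> E; apply/eqP; rewrite -subr_eq0; apply/eqP.
apply: (characters_independent Ky_char0
  (a := fun E => (s E)^-1 - \sum_lam (mult lam E)%:R * (schur lam)^-1)) E => h.
case: hs => _ /(_ h); rewrite /ak_trace => tr_eq.
under eq_bigr do rewrite mulrBl mulr_suml.
rewrite sumrB -tr_eq exchange_big /=; apply/eqP; rewrite subr_eq0; apply/eqP.
apply: eq_bigr => lam _; case: (multP lam) => -> _.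
by rewrite mulr_sumr; apply: eq_bigr => E _; rewrite mulrCA mulrA.
Qed.


Definition scalar_on_V w h := forall lam, V lam (iota h) = (val (omega w lam))%:M.

Lemma mult_scalar (mult : mpart l n -> Irr -> nat) lam E w h :
  (forall lam E, mult lam E != 0%N ->
     forall h, V lam (iota h) = 0 -> irr_mod E h = 0) ->
  mult lam E != 0%N -> scalar_on_V w h ->
  irr_mod E h = (laurent_val (omega w lam))%:M.
Proof.
move=> ann mE hV'; have [W WE] := restriction lam.
apply: (scalar_action (V := W) (a := omega w lam)); last by rewrite WE hV'.
by move=> h'; rewrite WE; exact: ann.
Qed.

Lemma epsilon_primitive : p.-primitive_root (kcst (zetaK l ^+ d)).
Proof.
have prim := dvdn_prim_root (zetaK_primitive l_gt0) p_dvd_l.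
rewrite /kcst (fmorph_primitive_root
  (@FracField.tofrac {poly cyclo l} \o @polyC (cyclo l) : {rmorphism cyclo l -> cycloy l})).
exact: prim.
Qed.

(** The l-partitions whose modules have E as a composition factor have the
    same contents up to rotation, so that no cancellation can occur in the
    expansion of the inverse of the Schur element of E. *)
Lemma constituent E : exists lam,
  (forall w h, scalar_on_V w h -> irr_mod E h = (laurent_val (omega w lam))%:M) /\
  exists2 a, a != 0 & (s E)^-1 = kcst a * (schur lam)^-1.
Proof.
have [mult [sE ann]] := schur_element_sum.
have sE0 : (s E)^-1 != 0 by case: hs => s0 _; rewrite invr_eq0; exact: s0.
have [lam mlam] : exists lam, mult lam E != 0%N.
  apply: contrapT => no; move: sE0; rewrite sE big1 ?eqxx // => lam _.
  have -> : mult lam E = 0%N by apply: contrapT => /eqP m0; apply: no; exists lam.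
  by rewrite mul0r.
exists lam; split=> [w h hV'|]; first exact: mult_scalar ann mlam hV'.
have term mu : exists x, is_const x /\
    (mult mu E)%:R * (schur mu)^-1 = x * (schur lam)^-1.
  have [m0|mmu] := eqVneq (mult mu E) 0%N.
    by exists 0; rewrite m0 !mul0r; split=> //; exact: (is_const_nat l 0).
  have [deg_gt0 _] : simple_hrep (irr_mod E) by exact: irr_simple.
  have same w : (p %| sumn w)%N -> \prod_(a <- w) psum (node_residues Q q mu) a
      = \prod_(a <- w) psum (node_residues Q q lam) a.
    move=> /central_elements [h hV'].
    rewrite -!val_central_value; apply: (scalar_mx_inj_gt0 deg_gt0).
    by rewrite -(mult_scalar ann mmu hV') -(mult_scalar ann mlam hV').
  have [j] := perm_eq_rotation Ky_char0 epsilon_primitive same.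
  rewrite -kcstX => perm_mu.
  have [h1 [h2 [h10 h20 e]]] := ak_schur_same_residues l_gt0 p_gt0 p_dvd_l perm_mu.
  exists ((mult mu E)%:R * (h1%:R * h2%:R^-1)); split.
    apply: is_constM; first exact: is_const_nat.
    by apply: is_constM; [|apply: is_constV]; exact: is_const_nat.
  rewrite -mulrA; congr (_ * _).
  by apply: ratio_nat e; rewrite Ky_nat_eq0 -lt0n.
have [x xP] := choice term.
have [|a aE] := @is_const_sum l _ x; first by move=> mu; case: (xP mu).
have e : (s E)^-1 = kcst a * (schur lam)^-1.
  by rewrite sE -aE mulr_suml; apply: eq_bigr => mu _; case: (xP mu).
exists a => //; apply: contraNneq sE0 => a0.
by rewrite e a0 /kcst polyC0 tofrac0 mul0r.
Qed.

Section SameBlock.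
Variables (eta : algC) (eta_neq0 : eta != 0).
Variables (Phi : {poly cyclo l}) (hPhi : is_minpoly eta Phi).
Variable theta : {rmorphism laurent l -> Qadj [:: zeta l; eta]}.
Hypothesis htheta : specialisation theta.

Lemma nu_schur_element E lam a : a != 0 ->
  (s E)^-1 = kcst a * (schur lam)^-1 -> nu Phi (s E) = nu Phi (schur lam).
Proof.
move=> a0 e; have schur0 := ak_schur_neq0 rs r l_gt0 p_gt0 lam.
have ka0 : kcst a != 0 by rewrite kcst_eq0.
have -> : s E = (kcst a)^-1 * schur lam by rewrite -[LHS]invrK e invfM invrK.
rewrite (nuM hPhi _ schur0); last by rewrite invr_eq0.
by rewrite (nuV hPhi ka0) (nu_kcst hPhi a0) oppr0 add0r.
Qed.

Lemma nu_brauer_edge E F :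
  brauer_edge theta (irr_mod E) (irr_mod F) -> nu Phi (s E) = nu Phi (s F).
Proof.
case=> k [M [e [e' [[k0 _] dE dF eN e'N]]]].
have [lam [lamE [a a0 sE]]] := constituent E.
have [mu [muF [b b0 sF]]] := constituent F.
rewrite (nu_schur_element a0 sE) (nu_schur_element b0 sF).
have annE := decomposition_number_ann dE eN.
have annF := decomposition_number_ann dF e'N.
have same w : (p %| sumn w)%N ->
    \prod_(a <- w) psum (node_residues (Qval rs eta) (qval p r eta) lam) a
  = \prod_(a <- w) psum (node_residues (Qval rs eta) (qval p r eta) mu) a.
  move=> /central_elements [h hV'].
  rewrite -!(theta_central_value rs r eta_neq0 htheta); congr val.
  apply: (scalar_mx_inj_gt0 k0).
  by rewrite -(scalar_action annE (lamE _ _ hV')) -(scalar_action annF (muF _ _ hV')).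
have prim := dvdn_prim_root (zeta_primitive l_gt0) p_dvd_l.
have [j perm_lam] := perm_eq_rotation (@pchar_num algC) prim same.
exact: nu_ak_schur_rotation perm_lam.
Qed.

Theorem nu_same_block E F : same_block theta E F -> nu Phi (s E) = nu Phi (s F).
Proof.
move/connectP => [path_EF]; elim: path_EF E => [|G path_GF IH] E /=; first by move=> _ ->.
by move=> /andP[/asboolP /nu_brauer_edge -> /IH].
Qed.

End SameBlock.
End Blocks.

Theorem theorem4p3p1 (l p n : nat)
  (l_gt0 : (0 < l)%N) (p_gt0 : (0 < p)%N) (p_dvd_l : (p %| l)%N)
  (hn : (2 < n)%N \/ (n = 2%N /\ odd p))
  (rs : (l %/ p).-tuple int) (r : int)
  (eta : algC) (eta_neq0 : eta != 0)
  (Phi : {poly cyclo l}) (hPhi : is_minpoly eta Phi)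
  (theta : {rmorphism laurent l -> Qadj [:: zeta l; eta]})
  (htheta : specialisation theta)
  (iota : {rmorphism cyc_hecke n rs r -> cyc_ak n rs r})
  (hiota : hecke_in_ak iota)
  (V : forall lam : mpart l n, hrep (cyc_ak_cst n rs r) id #|std_tab lam|)
  (hV : standard_labelling V)
  (Irr : irr_system (cyc_cst n rs r) (@laurent_val l))
  (s : Irr -> cycloy l) (hs : schur_elements iota V s)
  (E F : Irr) :
  same_block theta E F -> nu Phi (s E) = nu Phi (s F).
Proof.
have n_ge2 : (2 <= n)%N by case: hn => [/ltnW //|[-> _]].
exact: (nu_same_block l_gt0 p_gt0 p_dvd_l n_ge2 hiota hV hs eta_neq0 hPhi htheta).
Qed.
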